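(* In the setting below, for every $n\ge n_0$ we have $$r_{n+1}(y)\equiv r_n(y)^{\ell^{b-1}}\pmod{\ell^n}.$$ If moreover $Q=qI$ is scalar, then the stronger congruence $r_{n+1}(y)\equiv r_n(y)^{\ell^{b-1}}\pmod{\ell^{nb}}$ holds. (Congruences are coefficientwise, modulo the indicated power of $\ell$ in $\mathbb Z_\ell[\zeta_{\ell^{n+1}}]$.)
   Context: $\ell$ is an odd prime, $b,r\ge1$, $\Lambda=\mathbb Z_\ell[[T_1,\dots,T_b]]$. Fix primitive $\ell^n$-th roots of unity $\zeta_{\ell^n}$ with $\zeta_{\ell^{n+1}}^\ell=\zeta_{\ell^n}$. $Q\in\mathrm{GL}_b(\mathbb Z_\ell)$ lies in the kernel of $\mathrm{GL}_b(\mathbb Z_\ell)\to\mathrm{GL}_b(\mathbb F_\ell)$ and fixes no nonzero vector. A vector in $\mathbb Z_\ell^b$ or $(\mathbb Z/\ell^n\mathbb Z)^b$ is primitive if some coordinate is a unit; $\mathcal P((\mathbb Z/\ell^n\mathbb Z)^b)$ is the set of primitive vectors, on which $Q$ acts. For primitive $v$, $k_n(v)$ is the least positive $k$ with $Q^kv\equiv v\pmod{\ell^n}$, $k_n=\min_v k_n(v)$, and $n_0$ is the integer with $k_n=\ell^{n-n_0}$ for $n\ge n_0$ and $k_n=1$ for $n<n_0$. Let $F\in\mathrm{GL}_r(\Lambda)$; for $w\in\mathbb Z_\ell^b$, $F(\zeta_{\ell^n}^w)$ denotes substitution $T_i=\zeta_{\ell^n}^{w_i}-1$. Set $A_n(v)=F(\zeta_{\ell^n}^{Q^{k_n(v)-1}v})\cdots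 F(\zeta_{\ell^n}^{Qv})F(\zeta_{\ell^n}^{v})$ (depending only on $v$ mod $\ell^n$) and $p_{n,v}(y)=\det(I-yA_n(v))$, which depends only on the $Q$-orbit of $v$. Define $$r_n(y)=\prod_{v}p_{n,v}\big(y^{k_n(v)/k_n}\big),$$ the product over a set of representatives $v$ of the $Q$-orbits on $\mathcal P((\mathbb Z/\ell^n\mathbb Z)^b)$. *)

(* Defs.v *)
From HB Require Import structures.
From mathcomp Require Import all_boot all_order all_algebra.
From mathcomp Require Import boolp.
From mathcomp Require Import mpoly.

Set Implicit Arguments.
Unset Strict Implicit.
Unset Printing Implicit Defensive.

Import GRing.Theory.

(** * The ring of l-adic integers *)

(* As for 'Z_l in MathComp, the base is really [maxn l 2], so that the ring is
   never trivial; it is l as soon as l is prime. *)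
Definition padic_base (l : nat) : nat := (Zp_trunc l).+2.

Lemma padic_baseE (l : nat) : prime l -> padic_base l = l.
Proof. by move=> /prime_gt1; exact: Zp_cast. Qed.

(* The inverse limit of the Z / l^n: [x n] is the representative in
   {0, ..., l^n - 1} of x modulo l^n. *)
Record padic (l : nat) := Padic {
  padic_res :> nat -> nat;
  padic_resP : forall n, padic_res n = padic_res n.+1 %% padic_base l ^ n }.

Section PadicRing.
Variable l : nat.
Local Notation p := (padic_base l).
Implicit Types (x y z : padic l) (n : nat).

HB.instance Definition _ := gen_eqMixin (padic l).
HB.instance Definition _ := gen_choiceMixin (padic l).

Lemma padic_eq x y : (forall n, x n = y n) -> x = y.
Proof.
case: x y => [x xP] [y yP] /= /funext xy; case: _ / xy in yP *.
by congr Padic; exact: Prop_irrelevance.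
Qed.

Lemma padic_mod x n : x n %% p ^ n = x n.
Proof. by rewrite padic_resP modn_mod. Qed.

Lemma modn_padic_base m n : (m %% p ^ n.+1) %% p ^ n = m %% p ^ n.
Proof. by rewrite modn_dvdm // expnS dvdn_mull. Qed.

Definition padic_of_nat (m : nat) : padic l.
Proof.
exists (fun n => m %% p ^ n) => n.
by rewrite modn_padic_base.
Defined.

Definition padic_add x y : padic l.
Proof.
exists (fun n => (x n + y n) %% p ^ n)%N => n.
by rewrite modn_padic_base (padic_resP x) (padic_resP y) modnDm.
Defined.

Definition padic_mul x y : padic l.
Proof.
exists (fun n => (x n * y n) %% p ^ n)%N => n.
by rewrite modn_padic_base (padic_resP x) (padic_resP y) modnMm.
Defined.

Lemma padic_res_lt x n : (x n < p ^ n)%N.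
Proof. by rewrite -padic_mod ltn_mod expn_gt0. Qed.

Definition padic_opp x : padic l.
Proof.
exists (fun n => (p ^ n - x n) %% p ^ n)%N => n.
rewrite modn_padic_base; apply/eqP.
rewrite -(eqn_modDr (x n)) subnK ?(ltnW (padic_res_lt _ _)) // modnn.
rewrite (padic_resP x n) modnDmr subnK ?(ltnW (padic_res_lt _ _)) //.
by rewrite expnS modnMl.
Defined.

Lemma padic_addA : associative padic_add.
Proof. by move=> x y z; apply: padic_eq => n /=; rewrite modnDmr modnDml addnA. Qed.

Lemma padic_addC : commutative padic_add.
Proof. by move=> x y; apply: padic_eq => n /=; rewrite addnC. Qed.

Lemma padic_add0 : left_id (padic_of_nat 0) padic_add.
Proof. by move=> x; apply: padic_eq => n /=; rewrite mod0n add0n padic_mod. Qed.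

Lemma padic_addN : left_inverse (padic_of_nat 0) padic_opp padic_add.
Proof.
move=> x; apply: padic_eq => n /=.
by rewrite modnDml subnK ?(ltnW (padic_res_lt _ _)) // modnn mod0n.
Qed.

HB.instance Definition _ := GRing.isZmodule.Build (padic l)
  padic_addA padic_addC padic_add0 padic_addN.

Lemma padic_mulA : associative padic_mul.
Proof. by move=> x y z; apply: padic_eq => n /=; rewrite modnMmr modnMml mulnA. Qed.

Lemma padic_mulC : commutative padic_mul.
Proof. by move=> x y; apply: padic_eq => n /=; rewrite mulnC. Qed.

Lemma padic_mul1 : left_id (padic_of_nat 1) padic_mul.
Proof.
by move=> x; apply: padic_eq => n /=; rewrite modnMml mul1n padic_mod.
Qed.

Lemma padic_mulDl : left_distributive padic_mul padic_add.
Proof.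
by move=> x y z; apply: padic_eq => n /=; rewrite modnMml modnDm mulnDl.
Qed.

Lemma padic_1neq0 : padic_of_nat 1 != padic_of_nat 0.
Proof. by apply/eqP => /(congr1 (fun x : padic l => x 1%N)) /=; rewrite expn1. Qed.

HB.instance Definition _ := GRing.Zmodule_isComNzRing.Build (padic l)
  padic_mulA padic_mulC padic_mul1 padic_mulDl padic_1neq0.

End PadicRing.

Local Open Scope ring_scope.

(* Inversion in a commutative ring, by choice. *)
Section ClassicalInverse.
Variable R : comNzRingType.

Definition cunit : {pred R} := fun x => `[< exists y, y * x = 1 >].

Definition cinv (x : R) : R :=
  if pselect (exists y, y * x = 1) is left h then projT1 (cid h) else x.

Lemma cmulV : {in cunit, left_inverse 1 cinv *%R}.
Proof.
move=> x /asboolP h; rewrite /cinv.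
by case: pselect => // h'; case: cid.
Qed.

Lemma cunitP (x y : R) : y * x = 1 -> cunit x.
Proof. by move=> h; apply/asboolP; exists y. Qed.

Lemma cinv_out : {in [predC cunit], cinv =1 id}.
Proof.
move=> x /asboolP h; rewrite /cinv.
by case: pselect.
Qed.

End ClassicalInverse.

HB.instance Definition _ (l : nat) :=
  GRing.ComNzRing_hasMulInverse.Build (padic l)
    (@cmulV (padic l)) (@cunitP (padic l)) (@cinv_out (padic l)).

(** * Formal power series R[[T_1, ..., T_b]] *)

Record mpseries (b : nat) (R : comNzRingType) := MPSeries {
  pscoef :> 'X_{1..b} -> R }.

Section PowerSeriesRing.
Variables (b : nat) (R : comNzRingType).
Implicit Types (f g h : mpseries b R) (m : 'X_{1..b}).

HB.instance Definition _ := gen_eqMixin (mpseries b R).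
HB.instance Definition _ := gen_choiceMixin (mpseries b R).

Lemma mpseries_eq f g : (forall m, f m = g m) -> f = g.
Proof. by case: f g => [f] [g] /= /funext ->. Qed.

Definition ps0 : mpseries b R := MPSeries (fun=> 0).
Definition ps1 : mpseries b R := MPSeries (fun m => (m == 0%MM)%:R).
Definition ps_opp f : mpseries b R := MPSeries (fun m => - f m).
Definition ps_add f g : mpseries b R := MPSeries (fun m => f m + g m).
Definition ps_mul f g : mpseries b R := MPSeries (fun m =>
  \sum_(k : 'X_{1..b < (mdeg m).+1, (mdeg m).+1} | m == (k.1 + k.2)%MM)
    f k.1 * g k.2).

Lemma ps_addA : associative ps_add.
Proof. by move=> f g h; apply: mpseries_eq => m /=; rewrite addrA. Qed.
Lemma ps_addC : commutative ps_add.
Proof. by move=> f g; apply: mpseries_eq => m /=; rewrite addrC. Qed.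
Lemma ps_add0 : left_id ps0 ps_add.
Proof. by move=> f; apply: mpseries_eq => m /=; rewrite add0r. Qed.
Lemma ps_addN : left_inverse ps0 ps_opp ps_add.
Proof. by move=> f; apply: mpseries_eq => m /=; rewrite addNr. Qed.

HB.instance Definition _ := GRing.isZmodule.Build (mpseries b R)
  ps_addA ps_addC ps_add0 ps_addN.

Definition ps_trunc (d : nat) f : {mpoly R[b]} :=
  \sum_(m : 'X_{1..b < d}) f m *: 'X_[m].

Lemma ps_truncE d f m : (mdeg m < d)%N -> (ps_trunc d f)@_m = f m.
Proof. exact: mcoeff_mpoly. Qed.

Lemma ps_mulE d f g m : (mdeg m < d)%N ->
  ps_mul f g m = (ps_trunc d f * ps_trunc d g)@_m.
Proof.
move=> lt_md; rewrite mcoeffM; apply: eq_bigr => k _.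
by rewrite !ps_truncE // (leq_trans (bmdeg _)).
Qed.

Lemma ps_mulC : commutative ps_mul.
Proof.
by move=> f g; apply: mpseries_eq => m; rewrite !(@ps_mulE (mdeg m).+1) // mulrC.
Qed.

Lemma mcoeffM_eq (P P' S S' : {mpoly R[b]}) m :
  (forall k, (mdeg k <= mdeg m)%N -> P@_k = P'@_k) ->
  (forall k, (mdeg k <= mdeg m)%N -> S@_k = S'@_k) ->
  (P * S)@_m = (P' * S')@_m.
Proof.
move=> eP eS; rewrite !mcoeffM; apply: eq_bigr => k _.
by rewrite eP ?eS // -ltnS bmdeg.
Qed.

Lemma ps_mulA : associative ps_mul.
Proof.
move=> f g h; apply: mpseries_eq => m.
set d := (mdeg m).+1; rewrite !(@ps_mulE d) //.
transitivity (ps_trunc d f * (ps_trunc d g * ps_trunc d h))@_m.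
  by apply: mcoeffM_eq => // k le_km; rewrite ps_truncE // (@ps_mulE d).
rewrite mulrA; apply: mcoeffM_eq => // k le_km.
by rewrite ps_truncE // (@ps_mulE d).
Qed.

Lemma ps_mul1 : left_id ps1 ps_mul.
Proof.
move=> f; apply: mpseries_eq => m; set d := (mdeg m).+1.
rewrite (@ps_mulE d) //; transitivity (1 * ps_trunc d f)@_m.
  by apply: mcoeffM_eq => // k le_km; rewrite ps_truncE // mcoeff1.
by rewrite mul1r ps_truncE.
Qed.

Lemma ps_mulDl : left_distributive ps_mul ps_add.
Proof.
move=> f g h; apply: mpseries_eq => m /=.
by rewrite -big_split /=; apply: eq_bigr => k _; rewrite mulrDl.
Qed.

Lemma ps_1neq0 : ps1 != ps0.
Proof.
apply/eqP => /(congr1 (fun f : mpseries b R => f 0%MM)) /= /eqP.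
by rewrite eqxx oner_eq0.
Qed.

HB.instance Definition _ := GRing.Zmodule_isComNzRing.Build (mpseries b R)
  ps_mulA ps_mulC ps_mul1 ps_mulDl ps_1neq0.

HB.instance Definition _ :=
  GRing.ComNzRing_hasMulInverse.Build (mpseries b R)
    (@cmulV (mpseries b R)) (@cunitP (mpseries b R)) (@cinv_out (mpseries b R)).

End PowerSeriesRing.

(** * Z_l[z] and evaluation of power series *)

Section Evaluation.
Variables (l : nat) (K : fieldType) (iota : {rmorphism padic l -> K}).

Definition in_adjoin (z x : K) : Prop :=
  exists P : {poly padic l}, x = (map_poly iota P).[z].

Definition adjoin_eqmod (z : K) (N : nat) (x y : K) : Prop :=
  exists2 c, in_adjoin z c & x - y = (l ^ N)%:R * c.

Definition poly_eqmod (z : K) (N : nat) (P S : {poly K}) : Prop :=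
  forall i, adjoin_eqmod z N P`_i S`_i.

Definition adjoin_cvg (z : K) (u : nat -> K) (x : K) : Prop :=
  in_adjoin z x /\
  forall N, exists d0, forall d, (d0 <= d)%N -> adjoin_eqmod z N (u d) x.

Definition adjoin_lim (z : K) (u : nat -> K) : K :=
  if pselect (exists x, adjoin_cvg z u x) is left h then projT1 (cid h) else 0.

(* f(t_1, ..., t_b), as the limit of the partial sums of f for the l-adic
   topology of Z_l[z].  The limit exists and is unique when z is a root of unity
   of l-power order and each t_i is of the form z^a - 1; the default value 0 of
   [adjoin_lim] is then irrelevant. *)
Definition ps_eval (b : nat) (z : K) (t : 'I_b -> K) (f : mpseries b (padic l)) : K :=
  adjoin_lim z (fun d =>
    \sum_(m : 'X_{1..b < d}) iota (f m) * \prod_(i < b) t i ^+ m i).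

End Evaluation.

(** * The polynomials r_n *)

(* Least element of P; junk value 0 if P is empty. *)
Definition least (P : pred nat) : nat :=
  if pselect (exists k, P k) is left h then ex_minn h else 0%N.

(* Everything below is meant for n >= 1: recall that 'Z_(l ^ 0) is Z/2, not 0. *)
Section RPolynomials.
Variables (l b r : nat) (Q : 'M[padic l]_b).

Definition padic_modn (n : nat) (x : padic l) : 'Z_(l ^ n) := (x n)%:R.

Definition padic_modl (x : padic l) : 'F_l := (x 1%N)%:R.

Definition Qact (n k : nat) (v : 'cV['Z_(l ^ n)]_b) : 'cV['Z_(l ^ n)]_b :=
  map_mx (padic_modn n) (Q ^+ k) *m v.

Definition primitive_vec (n : nat) (v : 'cV['Z_(l ^ n)]_b) : bool :=
  [exists i, v i 0 \is a GRing.unit].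

Definition period (n : nat) (v : 'cV['Z_(l ^ n)]_b) : nat :=
  least (fun k => (0 < k)%N && (Qact k v == v)).

Definition min_period (n : nat) : nat :=
  least (fun k => [exists v : 'cV['Z_(l ^ n)]_b,
                     primitive_vec v && (period v == k)]).

Definition orbit_representatives (n : nat) (X : {set 'cV['Z_(l ^ n)]_b}) : Prop :=
  (forall v, v \in X -> primitive_vec v) /\
  (forall v, primitive_vec v ->
     exists! x, x \in X /\ exists k, x = Qact k v).

Variables (K : fieldType) (iota : {rmorphism padic l -> K}) (zeta : nat -> K).
Variable F : 'M[mpseries b (padic l)]_r.

Definition Fzeta (n : nat) (v : 'cV['Z_(l ^ n)]_b) : 'M[K]_r :=
  map_mx (ps_eval iota (zeta n) (fun i => zeta n ^+ (v i 0 : 'Z_(l ^ n)) - 1)) F.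

(* The factors are in decreasing order of the exponent of Q, from left to right. *)
Definition Amx (n : nat) (v : 'cV['Z_(l ^ n)]_b) : 'M[K]_r :=
  \prod_(j < period v) Fzeta (Qact (rev_ord j) v).

Definition ppoly (n : nat) (v : 'cV['Z_(l ^ n)]_b) : {poly K} :=
  \det (1%:M - 'X *: map_mx polyC (Amx v)).

Definition rpoly (n : nat) (X : {set 'cV['Z_(l ^ n)]_b}) : {poly K} :=
  \prod_(v in X) (ppoly v \Po 'X^(period v %/ min_period n)).

End RPolynomials.

(* Main.v *)
Require Import Defs.
From HB Require Import structures.
From mathcomp Require Import all_boot all_order all_algebra.
From mathcomp Require Import boolp.
From mathcomp Require Import mpoly.
From mathcomp Require Import perm ring zify.
Set Implicit Arguments.
Unset Strict Implicit.
Unset Printing Implicit Defensive.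
Import GRing.Theory.
Local Open Scope ring_scope.

(* Let T_n(m) be the sum of the traces of F(zeta^(Q^(m-1) v)) ... F(zeta^v) over the
   primitive v modulo l^n fixed by Q^m. Then - y r_n'/r_n has j-th coefficient
   T_n(j k_n) / k_n, so that, k_(n+1) being l k_n, the theorem follows from
   T_(n+1)(l m) = l^b T_n(m) modulo l^(N + v_l(l m)), with N = n or N = n b.
   Modulo l^N one may truncate F, which makes each entry of F(zeta^v) a finite sum of
   terms c zeta^(alpha v) with c in Z_l. Replacing (F, Q) by a product along blocks and a
   power of Q, one may assume that m is a power of l. Expanding the traces gives sums
   over words of length l m, each weighted by the sum of zeta^(beta v) over the fixed
   primitive v, and this sum is divisible by l^N (Ramanujan sums). Rotations of words
   preserve the summands: an orbit of length l m supplies the factor l m, and shorter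
   orbits consist of l-th powers of words of length m, whose contributions match those
   in T_n(m) by Fermat's congruence c^(l^(i+1)) = c^(l^i) modulo l^(i+1), because Q^(l m)
   fixes v modulo l^(n+1) exactly when Q^m fixes v modulo l^n. *)

(** * Divisibility by powers of l *)

(** Fermat's congruence holds for elements of Z_l but not for roots of unity, so coefficients and
    characters must be kept apart. Repeating a word l times multiplies its exponent by 1 + Q^m + ...
    + Q^((l-1)m), which acts as l on every vector fixed by Q^(l m); this uses that l divides 'C(l,
    2), hence that l is odd. So the character takes the value zeta_(n+1)^(l beta v) = zeta_n^(beta
    v), which depends only on v modulo l^n, and the l^b lifts of v produce the factor l^b without
    any error. Matrices are spread over matrix units, for which the trace of a positive power is the
    trace itself. The precision N + v_l(l m) is exactly what the return to polynomials consumes: for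
    m = j k_n, dividing by k_(n+1) costs v_l(k_(n+1)), and Newton's identities cost v_l(j) at the
    j-th coefficient. When m is a power of l, every proper divisor of l m divides m, so a word with
    a short orbit has period m. *)

Section Divisibility.
Variables (K : fieldType) (S : subringClosed K) (l : nat).

Definition dvl (N : nat) : {pred K} := fun x => x / l%:R ^+ N \in S.

Lemma dvlE N x : (x \in dvl N) = (x / l%:R ^+ N \in S).
Proof. by []. Qed.

Fact dvl_zmod_closed N : zmod_closed (dvl N).
Proof.
split=> [|x y]; rewrite !dvlE ?mul0r ?rpred0 // mulrBl.
exact: rpredB.
Qed.
HB.instance Definition _ N :=
  GRing.isZmodClosed.Build K (dvl N) (dvl_zmod_closed N).

Lemma dvl0 x : (x \in dvl 0) = (x \in S).
Proof. by rewrite dvlE expr0 invr1 mulr1. Qed.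

Hypothesis l_neq0 : l%:R != 0 :> K.

Lemma dvlMM M N x y : x \in dvl M -> y \in dvl N -> x * y \in dvl (M + N).
Proof.
rewrite !dvlE => Sx Sy; rewrite exprD invfM mulrACA; exact: rpredM.
Qed.

Lemma dvlMl N a x : a \in S -> x \in dvl N -> a * x \in dvl N.
Proof. by rewrite -dvl0; exact: dvlMM. Qed.

Lemma dvlMr N a x : a \in S -> x \in dvl N -> x * a \in dvl N.
Proof. by rewrite mulrC; exact: dvlMl. Qed.

Lemma dvlMXl k N x : (l%:R ^+ k * x \in dvl (k + N)) = (x \in dvl N).
Proof.
rewrite !dvlE exprD invfM mulrA [l%:R ^+ k * x]mulrC mulfK //.
by rewrite expf_neq0.
Qed.

Lemma dvl_exp k : l%:R ^+ k \in dvl k.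
Proof. by rewrite dvlE divff ?expf_neq0 // rpred1. Qed.

Lemma dvlP N x : reflect (exists2 c, c \in S & x = l%:R ^+ N * c) (x \in dvl N).
Proof.
apply: (iffP idP) => [Sx|[c Sc ->]].
  by exists (x / l%:R ^+ N); rewrite // mulrC divfK // expf_neq0.
by rewrite -[N in dvl N]addn0 dvlMXl dvl0.
Qed.

Lemma dvl_leq M N x : (M <= N)%N -> x \in dvl N -> x \in dvl M.
Proof.
move=> /subnKC <- /dvlP[c Sc ->]; rewrite exprD -mulrA -[M in dvl M]addn0 dvlMXl.
by rewrite dvl0 rpredM // rpredX // rpred_nat.
Qed.

Lemma dvl_nat k m : (l ^ k %| m)%N -> m%:R \in dvl k.
Proof.
case/dvdnP => q ->; rewrite natrM natrX.
by apply: dvlMl; [exact: rpred_nat|exact: dvl_exp].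
Qed.

Lemma dvlX N x k : x \in dvl N -> x ^+ k \in dvl (N * k).
Proof.
move=> xN; elim: k => [|k IH]; first by rewrite muln0 dvl0 rpred1.
by rewrite exprS mulnS; exact: dvlMM.
Qed.

(** Bezout makes [m] invertible modulo [l ^ N]; the correction term is a multiple of [l ^ N * x],
    whence the hypothesis that [x] is in [S]. *)
Lemma dvl_coprime N m x :
  coprime m l -> (0 < m)%N -> x \in S -> m%:R * x \in dvl N -> x \in dvl N.
Proof.
move=> co_ml m_gt0 Sx Nmx; have := coprimeXr N co_ml => co.
case: (egcdnP (l ^ N) m_gt0) => u v def_u _.
move: co; rewrite /coprime => /eqP gcd1; rewrite gcd1 in def_u.
have -> : x = u%:R * (m%:R * x) - (v * l ^ N)%:R * x.
  by rewrite mulrA -natrM def_u natrD mulrDl mul1r addrAC subrr add0r.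
rewrite rpredB //; first by rewrite dvlMl ?rpred_nat.
by rewrite dvlMr // dvl_nat // dvdn_mull.
Qed.

Lemma dvl_subX N x y k :
  x \in S -> y \in S -> x - y \in dvl N -> x ^+ k - y ^+ k \in dvl N.
Proof.
move=> Sx Sy xy; rewrite subrXX dvlMr // rpred_sum // => i _.
by rewrite rpredM // rpredX.
Qed.

(** Modulo l, the cofactor of [x - y] in [x ^+ l - y ^+ l] is [l%:R * y ^+ l.-1], because [k] is
    positive; it supplies the additional factor l. *)
Lemma dvl_subXl k x y : x \in S -> y \in S -> (0 < k)%N ->
  x - y \in dvl k -> x ^+ l - y ^+ l \in dvl k.+1.
Proof.
move=> Sx Sy k_gt0 xy; rewrite subrXX -addn1 dvlMM //.
have -> : \sum_(i < l) x ^+ (l.-1 - i) * y ^+ i =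
    \sum_(i < l) (x ^+ (l.-1 - i) - y ^+ (l.-1 - i)) * y ^+ i + l%:R * y ^+ l.-1.
  rewrite (eq_bigr (fun i : 'I_l => (x ^+ (l.-1 - i) - y ^+ (l.-1 - i)) * y ^+ i
     + y ^+ l.-1)).
    by rewrite big_split /= sumr_const card_ord mulr_natl.
  move=> i _; rewrite mulrBl -exprD subnK ?subrK //.
  by rewrite -ltnS prednK // (leq_ltn_trans _ (ltn_ord i)).
rewrite rpredD //; last by apply: dvlMr; rewrite ?rpredX //; exact: (dvl_exp 1).
apply: rpred_sum => i _; rewrite dvlMr ?rpredX //.
by apply: dvl_leq k_gt0 _; exact: dvl_subX.
Qed.

(** The congruence modulo l is assumed for the given [x], as it may fail for roots of unity in [S];
    each further l-th power gains a factor l by [dvl_subXl]. *)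
Lemma dvl_Fermat k x : x \in S -> x ^+ l - x \in dvl 1 ->
  x ^+ (l ^ k.+1) - x ^+ (l ^ k) \in dvl k.+1.
Proof.
move=> Sx Fx; elim: k => [|k IH]; first by rewrite expn1.
rewrite (expnSr l k.+1) [in X in _ - X]expnSr !exprM.
by apply: dvl_subXl; rewrite ?rpredX.
Qed.

End Divisibility.

(** * Logarithmic derivatives *)

Section LogarithmicDerivative.
Variable K : fieldType.
Implicit Types (P Q D : {poly K}) (t u : nat -> K).

Lemma coefM_eq0 P Q k : (forall i, (i <= k)%N -> P`_i = 0) -> (P * Q)`_k = 0.
Proof.
move=> P0; rewrite coefM big1 // => i _.
by rewrite P0 ?mul0r // -ltnS ltn_ord.
Qed.

(* [- X P' / P] is the power series with coefficients [t]. *)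
Definition logder P t := forall M k, (k < M)%N ->
  ('X * P^`() + P * \poly_(i < M) t i)`_k = 0.

Lemma logder_eq P t u : t =1 u -> logder P t -> logder P u.
Proof.
move=> tu Pt M k kM.
have -> : \poly_(i < M) u i = \poly_(i < M) t i.
  by apply/polyP => i; rewrite !coef_poly tu.
exact: Pt.
Qed.

Lemma logder1 : logder 1 (fun=> 0).
Proof.
move=> M k _; rewrite -polyC1 derivC mulr0 add0r mul1r coef_poly.
by case: ifP.
Qed.

Lemma logderM P Q t u :
  logder P t -> logder Q u -> logder (P * Q) (fun j => t j + u j).
Proof.
move=> Pt Qu M k kM.
have -> : \poly_(i < M) (t i + u i) = \poly_(i < M) t i + \poly_(i < M) u i.
  by apply/polyP => i; rewrite coefD !coef_poly; case: ifP; rewrite ?addr0.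
set tp := \poly_(i < M) t i; set up := \poly_(i < M) u i.
have -> : 'X * (P * Q)^`() + P * Q * (tp + up) =
   ('X * P^`() + P * tp) * Q + ('X * Q^`() + Q * up) * P.
  by rewrite derivM; ring.
rewrite coefD !coefM_eq0 ?addr0 // => i ik.
  by rewrite Qu // (leq_ltn_trans ik).
by rewrite Pt // (leq_ltn_trans ik).
Qed.

Lemma logder_prod (I : finType) (A : {pred I}) (P : I -> {poly K})
    (t : I -> nat -> K) : (forall i, i \in A -> logder (P i) (t i)) ->
  logder (\prod_(i in A) P i) (fun j => \sum_(i in A) t i j).
Proof.
move=> Pt; rewrite -big_filter.
apply: (@logder_eq _ (fun j => \sum_(i <- [seq i <- index_enum I | i \in A]) t i j)).
  by move=> j; rewrite big_filter.
have: {subset [seq i <- index_enum I | i \in A] <= A}.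
  by move=> i; rewrite mem_filter => /andP[].
elim: [seq _ <- _ | _] => [|i s IH] sA.
  by rewrite big_nil; apply: logder_eq logder1 => j; rewrite big_nil.
rewrite big_cons; apply: (@logder_eq _ (fun j => t i j + \sum_(i <- s) t i j)).
  by move=> j; rewrite big_cons.
apply: logderM; first by apply: Pt; apply: sA; rewrite inE eqxx.
by apply: IH => j js; apply: sA; rewrite inE js orbT.
Qed.

Lemma logderX P t m : logder P t -> logder (P ^+ m) (fun j => m%:R * t j).
Proof.
move=> Pt; elim: m => [|m IH].
  by apply: logder_eq logder1 => j; rewrite mul0r.
rewrite exprS; apply: logder_eq (logderM Pt IH) => j.
by rewrite -natr1 mulrDl mul1r addrC.
Qed.

Lemma logder_compXn P t c : (0 < c)%N -> logder P t ->
  logder (P \Po 'X^c) (fun j => if (c %| j)%N then c%:R * t (j %/ c)%N else 0).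
Proof.
move=> c_gt0 Pt M k kM; rewrite deriv_comp derivXn.
set tp := \poly_(i < M) t i; set up := \poly_(i < M) _.
(* The chain rule leaves the difference of two series that agree below degree [M]; from there on
   [tp \Po 'X^c] may have terms that [up] lacks. *)
have -> : 'X * ((P^`() \Po 'X^c) * ('X^(c.-1) *+ c)) + (P \Po 'X^c) * up =
   c%:R *: (('X * P^`() + P * tp) \Po 'X^c) +
   (up - c%:R *: (tp \Po 'X^c)) * (P \Po 'X^c).
  rewrite comp_polyD !comp_polyM comp_polyX -[c in 'X^c * _]prednK // exprS.
  by rewrite -!mul_polyC polyC_natr; ring.
rewrite coefD coefZ coef_comp_poly_Xn // coefM_eq0.
  case: ifP => ck; last by rewrite mulr0 addr0.
  by rewrite Pt ?mulr0 ?addr0 // (leq_ltn_trans (leq_div _ _)).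
move=> i ik; rewrite coefB coefZ coef_comp_poly_Xn // !coef_poly.
rewrite (leq_ltn_trans ik kM) (leq_ltn_trans (leq_div _ _) (leq_ltn_trans ik kM)).
by case: ifP; rewrite ?mulr0 subrr.
Qed.

(** For [1 + a *: 'X] this is a geometric series, into which 'X^k is substituted. *)
Lemma logder_1DZXn (a : K) k : (0 < k)%N -> logder (1 + a *: 'X^k)
  (fun j => if (k %| j)%N then k%:R * ((0 < j %/ k)%N%:R * (- a) ^+ (j %/ k)%N) else 0).
Proof.
move=> k_gt0.
have -> : 1 + a *: 'X^k = (1 + a *: 'X) \Po 'X^k.
  by rewrite comp_polyD comp_polyZ comp_polyX -polyC1 comp_polyC.
apply: (@logder_compXn _ (fun j => (0 < j)%N%:R * (- a) ^+ j)) => // M j jM.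
rewrite -polyC1 derivD derivZ derivC derivX add0r mulrDl polyC1 mul1r.
rewrite -scalerAl -scalerAr mulr1 !(coefD, coefZ, coefX, coefXM, coef_poly) jM.
case: j jM => [|[|j]] jM /=; rewrite ?mulr0 ?mul0r ?addr0 //=.
  by rewrite (ltnW jM) /=; ring.
by rewrite (ltnW jM) /= !exprS; ring.
Qed.

Variables (S : subringClosed K) (l : nat).
Hypothesis l_neq0 : l%:R != 0 :> K.
Hypothesis l_pr : prime l.
Local Notation dvl := (dvl S l).

Lemma coefM_lead P Q k : P`_0 = 1 -> (forall i, (i < k)%N -> Q`_i = 0) ->
  (P * Q)`_k = Q`_k.
Proof.
move=> P0 Q0; rewrite mulrC coefM big_ord_recr /= subnn P0 mulr1 big1 ?add0r //.
by move=> i _; rewrite Q0 ?mul0r.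
Qed.

(** Newton's identities: the coefficient of X^k in the defining relation is k D_k + t_k plus terms
    of lower index, and these coincide for the two series. *)
Lemma logder_lead D D' t t' k : (0 < k)%N -> D`_0 = 1 -> D'`_0 = 1 ->
  logder D t -> logder D' t' -> (forall i, (i < k)%N -> D`_i = D'`_i) ->
  k%:R * (D`_k - D'`_k) = t' k - t k.
Proof.
move=> k_gt0 D0 D'0 Dt Dt' eqDD'.
set tp := \poly_(i < k.+1) t i; set tp' := \poly_(i < k.+1) t' i.
have t'0 : tp'`_0 = 0.
  by have := Dt' 1%N 0%N isT; rewrite coefD coefXM add0r coefM big_ord1 D'0 mul1r !coef_poly.
have dD0 i : (i < k)%N -> (D - D')`_i = 0.
  by move=> ik; rewrite coefB eqDD' ?subrr.
have E i : (i <= k)%N -> (D * (tp - tp'))`_i = - (i%:R * (D - D')`_i).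
  move=> ik; have := Dt k.+1 i ik; have := Dt' k.+1 i ik.
  rewrite -/tp -/tp' => h' h.
  have -> : D * (tp - tp') = ('X * D^`() + D * tp) - ('X * D'^`() + D' * tp')
      - 'X * (D - D')^`() - (D - D') * tp' by rewrite derivB; ring.
  rewrite !coefB h h' subrr sub0r -coefB.
  have -> : ((D - D') * tp')`_i = 0.
    rewrite coefM big_ord_recr /= subnn t'0 mulr0 addr0 big1 // => j _.
    by rewrite dD0 ?mul0r // (leq_trans (ltn_ord j)).
  rewrite coefXM coef_deriv subr0.
  by case: i ik {h h'} => [|i] _ /=; rewrite ?mul0r // mulr_natl.
have tp0 i : (i < k)%N -> (tp - tp')`_i = 0.
  elim/ltn_ind: i => i IH ik; rewrite -(@coefM_lead D) //.
    by rewrite E ?dD0 ?mulr0 ?oppr0 // ltnW.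
  by move=> j ji; rewrite IH // (ltn_trans ji).
have := E k (leqnn k); rewrite coefM_lead // !coefB !coef_poly ltnSn => h.
by rewrite -[LHS]opprK -h opprB.
Qed.

(* [D'] is multiplied successively by factors [1 + x X^k], [x] in [l^N S], which
   keep the hypothesis on logarithmic derivatives, so as to agree with [D] up to
   any given order. *)
Lemma logder_dvl N D D' t t' : (0 < N)%N ->
  D \is a polyOver S -> D' \is a polyOver S -> D`_0 = 1 -> D'`_0 = 1 ->
  logder D t -> logder D' t' ->
  (forall j, (0 < j)%N -> t j - t' j \in dvl (N + logn l j)) ->
  forall i, D`_i - D'`_i \in dvl N.
Proof.
move=> N_gt0 SD SD' D0 D'0 Dt Dt' tt' i.
suff [E [SE E0 EN _ eqE]] : exists E : {poly K},
  [/\ E \is a polyOver S, E`_0 = 1, E - 1 \is a polyOver (dvl N),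
   exists2 u, logder E u & forall j, (0 < j)%N -> u j \in dvl (N + logn l j)
   & forall j, (j < i.+1)%N -> (D' * E)`_j = D`_j].
  rewrite -eqE // -coefB -[D' in X in _ - X]mulr1 -mulrBr coefM.
  apply: rpred_sum => j _; rewrite dvlMl ?(polyOverP SD') //.
  exact: (polyOverP EN).
elim: i => [|k [E [SE E0 EN [u Eu uN] eqE]]].
  exists 1; split; rewrite ?rpred1 ?subrr ?rpred0 ?coef1 //.
    by exists (fun=> 0); [exact: logder1|move=> j _; exact: rpred0].
  by case=> // _; rewrite mulr1 D0 D'0.
move: {k}k.+1 (ltn0Sn k) eqE => k k_gt0 eqE.
have D'E0 : (D' * E)`_0 = 1 by rewrite eqE.
set x := D`_k - (D' * E)`_k.
have Sx : x \in S.
  by rewrite rpredB ?(polyOverP SD) // (polyOverP (rpredM SD' SE)).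
have xN : x \in dvl N.
  have kx : k%:R * x = (t' k - t k) + u k.
    have eqE' j : (j < k)%N -> D`_j = (D' * E)`_j by move/eqE.
    by rewrite (logder_lead k_gt0 _ _ Dt (logderM Dt' Eu) eqE') // addrAC.
  have [m co_lm def_k] := pfactor_coprime l_pr k_gt0.
  apply: (@dvl_coprime _ _ _ l_neq0 N m) => //; first by rewrite coprime_sym.
    by move: k_gt0; rewrite def_k muln_gt0 => /andP[].
  rewrite -(@dvlMXl _ _ _ l_neq0 (logn l k)) mulrA -natrX -natrM [(_ * m)%N]mulnC.
  by rewrite -def_k kx addnC rpredD ?uN // -opprB rpredN tt'.
exists (E * (1 + x *: 'X^k)); split.
- rewrite rpredM // rpredD ?rpred1 // polyOverZ // rpredX //; exact: polyOverX.
- rewrite coefM big_ord1 E0 mul1r coefD coef1 coefZ coefXn.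
  by rewrite -[k]prednK // mulr0 addr0.
- have -> : E * (1 + x *: 'X^k) - 1 = (E - 1) + x *: (E * 'X^k).
    by rewrite -!mul_polyC; ring.
  rewrite rpredD //; apply/polyOverP => j; rewrite coefZ dvlMr // coefMXn.
  by case: ifP => _; rewrite ?rpred0 // (polyOverP SE).
- eexists; first exact: logderM Eu (logder_1DZXn x k_gt0).
  move=> j j_gt0; rewrite rpredD ?uN //; case: ifP => [kj|_]; last exact: rpred0.
  have e_gt0 : (0 < j %/ k)%N by rewrite divn_gt0 // dvdn_leq.
  rewrite e_gt0 mul1r -[j in logn l j](divnK kj) lognM // addnA addnC.
  rewrite dvlMM ?dvl_nat ?pfactor_dvdnn //.
  have NxN : - x \in dvl N by rewrite rpredN.
  (* With e = j / k, one has N e >= N + v_l(e) because v_l(e) < e and N is positive; the factor k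
     has already supplied v_l(k). *)
  apply: (dvl_leq l_neq0 _ (dvlX (j %/ k)%N NxN)).
  have := ltn_logl l e_gt0; move: (j %/ k)%N (logn _ _) => e f.
  case: e => // e; rewrite mulnS leq_add2l ltnS => fe.
  by rewrite (leq_trans fe) // leq_pmull.
- move=> j; rewrite ltnS leq_eqVlt mulrA mulrDr mulr1 -scalerAr coefD coefZ coefMXn.
  case/orP => [/eqP ->|jk]; last by rewrite jk mulr0 addr0 eqE.
  by rewrite ltnn subnn D'E0 mulr1 addrC subrK.
Qed.

End LogarithmicDerivative.

(** * Logarithmic derivative of det(1 - XA) *)

Section CharacteristicPolynomial.
Variable K : fieldType.

Lemma deriv_prod (I : finType) (F : I -> {poly K}) :
  (\prod_i F i)^`() = \sum_i (F i)^`() * \prod_(j | j != i) F j.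
Proof.
have H (s : seq I) : uniq s -> (\prod_(i <- s) F i)^`() =
    \sum_(i <- s) (F i)^`() * \prod_(j <- s | j != i) F j.
  elim: s => [|i s IH]; first by rewrite !big_nil -polyC1 derivC.
  rewrite cons_uniq => /andP[i_s /IH E]; rewrite !big_cons derivM E eqxx /=.
  congr (_ * _ + _).
    by rewrite [RHS]big_seq_cond [LHS]big_seq; apply: eq_bigl => j;
      case js: (j \in s) => //=; apply/esym; apply: contraNneq i_s => <-.
  rewrite mulr_sumr big_seq [RHS]big_seq; apply: eq_bigr => j js.
  rewrite big_cons ifT; first by rewrite mulrCA.
  by apply: contraNneq i_s => ->.
by rewrite H ?index_enum_uniq.
Qed.

(** Differentiating the Leibniz expansion gives the sum over i of the determinants with row i
    differentiated; expanding each along that row brings in the cofactors of [B]. *)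
Lemma deriv_det n (B : 'M[{poly K}]_n) :
  (\det B)^`() = \tr (map_mx deriv B *m \adj B).
Proof.
pose Bi (i : 'I_n) := \matrix_(k, j) if k == i then (B i j)^`() else B k j.
transitivity (\sum_i \det (Bi i)).
  rewrite /determinant raddf_sum exchange_big /=; apply: eq_bigr => s _.
  rewrite -mulr_sumr.
  have -> : ((-1) ^+ odd_perm s * \prod_i B i (s i))^`()
    = (-1) ^+ odd_perm s * (\prod_i B i (s i))^`().
    by case: (odd_perm s); rewrite ?expr1 ?expr0 ?mul1r // !mulN1r derivN.
  rewrite deriv_prod; congr (_ * _); apply: eq_bigr => i _.
  rewrite [RHS](bigD1 i) //= mxE eqxx; congr (_ * _).
  by apply: eq_bigr => j /negPf ji; rewrite mxE ji.
rewrite /mxtrace; apply: eq_bigr => i _; rewrite mxE (expand_det_row _ i).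
apply: eq_bigr => j _; rewrite !mxE eqxx; congr (_ * (_ * \det _)).
by apply/matrixP => x y; rewrite !mxE eq_sym (negPf (neq_lift _ _)).
Qed.

Lemma coef0_det n (A : 'M[K]_n) :
  (\det (1%:M - 'X *: map_mx polyC A))`_0 = 1.
Proof.
rewrite -horner_coef0 -horner_evalE -det_map_mx -[RHS](det1 K n); congr (\det _).
apply/matrixP => i j; rewrite !mxE /= horner_evalE hornerD hornerN hornerM hornerX mul0r subr0.
by rewrite -polyC_natr hornerC.
Qed.

(* Jacobi's formula for the derivative of [\det B], combined with the geometric
   series for the inverse of [B = 1 - XA]. *)
Lemma logder_det n (A : 'M[K]_n) :
  logder (\det (1%:M - 'X *: map_mx polyC A)) (fun j => (0 < j)%N%:R * \tr (A ^+ j)).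
Proof.
case=> // M k kM; set Ap := map_mx polyC A; set B := 1%:M - 'X *: Ap.
have dB : map_mx deriv B = - Ap.
  apply/matrixP => i j; rewrite !mxE derivB derivM derivX derivC mul1r mulr0 addr0.
  by rewrite -polyC_natr derivC sub0r.
pose G := \sum_(i < M) 'X^i *: Ap ^+ i.
have BG : B *m G = 1%:M - 'X^M *: Ap ^+ M.
  rewrite /G; elim: (M) => [|m IH].
    by rewrite big_ord0 mulmx0 expr0 scale1r expr0 subrr.
  rewrite big_ord_recr /= mulmxDr IH /B mulmxBl mul1mx -scalemxAl -scalemxAr.
  by rewrite scalerA -exprS -[Ap *m _]/(Ap * _) -exprS addrA subrK.
have tp : \poly_(i < M.+1) ((0 < i)%N%:R * \tr (A ^+ i)) = 'X * \tr (Ap *m G).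
  rewrite poly_def big_ord_recl /= mul0r scale0r add0r mulmx_sumr raddf_sum mulr_sumr.
  apply: eq_bigr => i _; rewrite /bump /= add1n mul1r -scalemxAr mxtraceZ mulrA -exprS.
  rewrite mulrC -[Ap *m _]/(Ap * _) -exprS -mul_polyC; congr (_ * _).
  have -> : Ap ^+ i.+1 = map_mx polyC (A ^+ i.+1).
    by elim: i.+1 => [|m IH]; rewrite ?expr0 ?map_mx1 // !exprS map_mxM IH.
  by rewrite -trace_map_mx.
(* The adjugate replaces the inverse of [B]; the tail of the geometric series then survives only as
   a multiple of 'X^(M.+1). *)
have PG : \det B *: G = \adj B *m (1%:M - 'X^M *: Ap ^+ M).
  by rewrite -BG mulmxA mul_adj_mx mul_scalar_mx.
have -> : 'X * (\det B)^`() + \det B * \poly_(i < M.+1) ((0 < i)%N%:R * \tr (A ^+ i)) =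
   'X^(M.+1) * - \tr (Ap *m (\adj B *m Ap ^+ M)).
  rewrite tp deriv_det dB mulNmx raddfN /= (mulrCA (\det B)) -mxtraceZ scalemxAr PG.
  rewrite mulmxBr mulmx1 -scalemxAr mulmxBr raddfB /= -scalemxAr mxtraceZ.
  by rewrite mulrBr mulrN addrA addNr sub0r mulrA -exprS mulrN.
by rewrite coefXnM kM.
Qed.

End CharacteristicPolynomial.

(** * Invariant sums over orbits *)

Section Rotations.

Lemma dvdn_order (T : finType) (f : T -> T) x m :
  injective f -> iter m f x = x -> (order f x %| m)%N.
Proof.
move=> f_inj; rewrite {1}(divn_eq m (order f x)) addnC iterD mulnC.
have -> : iter (order f x * (m %/ order f x)) f x = x.
  by elim: (_ %/ _)%N => [|k IH]; rewrite ?muln0 // mulnS iterD IH iter_order.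
set s := (m %% _)%N => fs; have s_lt : (s < order f x)%N by rewrite ltn_mod order_gt0.
rewrite /dvdn -/s; apply/eqP; have := findex_iter s_lt; rewrite fs.
by rewrite findex0.
Qed.

Lemma sum_orbit (K : zmodType) (T : finType) (f : T -> T) (h : T -> K) x :
  (forall y, h (f y) = h y) -> \sum_(y | fconnect f x y) h y = h x *+ order f x.
Proof.
move=> hf; rewrite -sumr_const; apply: eq_bigr => y /iter_findex <-.
by elim: (findex f x y) => //= k IH; rewrite hf.
Qed.

(** An orbit contributes its length times the common value of [h] on it, so the length may supply
    part of the power of l. *)
Lemma dvl_sum_orbits (K : fieldType) (S : subringClosed K) (l N : nat)
    (T : finType) (f : T -> T) (h : T -> K) : injective f ->
  (forall y, h (f y) = h y) ->
  (forall x, (order f x)%:R * h x \in dvl S l N) -> \sum_x h x \in dvl S l N.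
Proof.
move=> f_inj hf hN; rewrite (partition_big (froot f) (froots f)) /=; last first.
  by move=> x _; exact: roots_root (fconnect_sym f_inj) _.
apply: rpred_sum => x /eqP rx.
rewrite (eq_bigl (fconnect f x)); first by rewrite sum_orbit // -mulr_natl.
move=> y; rewrite -(root_connect (fconnect_sym f_inj)).
by rewrite rx eq_sym.
Qed.

End Rotations.

Lemma big_nat_mul (R : Type) (idx : R) (op : Monoid.law idx) (F : nat -> R) m k :
  \big[op/idx]_(0 <= t < k * m) F t =
  \big[op/idx]_(0 <= i < k) \big[op/idx]_(0 <= t < m) F (i * m + t)%N.
Proof.
elim: k => [|k IH]; first by rewrite mul0n !big_geq.
rewrite big_nat_recr //= -IH mulSnr (@big_cat_nat _ _ _ (k * m)%N) ?leq_addr //=.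
by congr (op _ _); rewrite -{1}[(k * m)%N]add0n big_addn addKn;
  apply: eq_bigr => i _; rewrite addnC.
Qed.

(** * Character sums over Z/l^n *)

Section CharacterSums.

Lemma ex_rmorphism (R R' : pzRingType) (f : R -> R') :
  zmod_morphism f -> monoid_morphism f -> exists g : {rmorphism R -> R'}, g =1 f.
Proof.
move=> fB fM.
pose z := GRing.isZmodMorphism.Build R R' f fB.
pose m := GRing.isMonoidMorphism.Build R R' f fM.
by exists (HB.pack_for {rmorphism R -> R'} f z m).
Qed.

(** The fibres of a surjective additive map are translates of one another. *)
Lemma card_fiber (U V : finZmodType) (f : U -> V) y :
  (forall x z, f (x + z) = f x + f z) -> (forall z, exists x, f x = z) ->
  (#|[pred x | f x == y]| * #|V| = #|U|)%N.
Proof.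
move=> fD f_surj; rewrite -[RHS]sum1_card (partition_big f predT) //=.
rewrite (eq_bigr (fun=> #|[pred x | f x == y]|)); first by rewrite sum_nat_const mulnC.
move=> z _; have [x fx] := f_surj (z - y).
rewrite -sum1_card (reindex_inj (addIr x)) /=; apply: eq_bigl => t.
by rewrite !inE fD fx addrCA -subr_eq0 addrAC subrr add0r subr_eq0.
Qed.

Variable K : fieldType.

(** If [psi y] differs from 1 for some [y] in [H], translation by [y] multiplies the sum by [psi y],
    which forces it to vanish. *)
Lemma sum_character (V : finZmodType) (psi : V -> K) (H : {pred V}) : zmod_closed H ->
  (forall x y, psi (x + y) = psi x * psi y) ->
  (forall x, psi x != 0) ->
  \sum_(x in H) psi x = 0 \/ \sum_(x in H) psi x = #|H|%:R.
Proof.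
move=> [H0 HB] psiD psi0.
have [/forall_inP psi1|] := boolP [forall x in H, psi x == 1].
  right; rewrite -[RHS]sumr_const; apply: eq_bigr => x /psi1; exact: eqP.
rewrite negb_forall_in => /exists_inP[y Hy psiy]; left.
have E : \sum_(x in H) psi x = psi y * \sum_(x in H) psi x.
  rewrite {1}(reindex_inj (addrI y)) /= mulr_sumr.
  rewrite (eq_bigl (fun x => x \in H)); first by apply: eq_bigr => x _; rewrite psiD.
  move=> x; apply/idP/idP => [yx|Hx].
    by rewrite -[x](addrK y) HB // addrC.
  by rewrite addrC -[y]opprK -[- y]sub0r !HB.
move/eqP: E; rewrite -[X in X == _]mul1r -subr_eq0 -mulrBl mulf_eq0 subr_eq0 eq_sym.
by rewrite (negPf psiy) => /eqP.
Qed.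

Variables (l : nat) (l_pr : prime l).

Lemma expl_gt1 n : (1 < l ^ n.+1)%N.
Proof. by rewrite -{1}(exp1n n.+1) ltn_exp2r // prime_gt1. Qed.
Hint Resolve expl_gt1 : core.

Lemma Zl_card n : #|'Z_(l ^ n.+1)| = (l ^ n.+1)%N.
Proof. by rewrite card_ord Zp_cast. Qed.

Lemma Zl_natr0 n : (l%:R : 'Z_(l ^ n.+1)) ^+ n.+1 = 0.
Proof. by rewrite -natrX pchar_Zp. Qed.

Lemma Zl_natr_eq0 n m : (m%:R == 0 :> 'Z_(l ^ n.+1)) = (l ^ n.+1 %| m)%N.
Proof. by rewrite -val_eqE /= val_Zp_nat. Qed.

Lemma Zl_unitE n (x : 'Z_(l ^ n.+1)) : (x \is a GRing.unit) = ~~ (l %| x)%N.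
Proof.
rewrite -[x in LHS]natr_Zp unitZpE // coprime_pexpl //.
by rewrite prime_coprime.
Qed.

(** A ring morphism for [n <= m] only. Exponents are successors because 'Z_(l ^ 0) is Z/2. *)
Definition Zl_red m n (x : 'Z_(l ^ m.+1)) : 'Z_(l ^ n.+1) := (x : nat)%:R.

Lemma Zl_redP m n : (n <= m)%N -> exists f : {rmorphism 'Z_(l ^ m.+1) -> 'Z_(l ^ n.+1)},
  f =1 @Zl_red m n.
Proof.
move=> nm; have dvd : (l ^ n.+1 %| (Zp_trunc (l ^ m.+1)).+2)%N.
  by rewrite Zp_cast // dvdn_exp2l.
have redD (x y : 'Z_(l ^ m.+1)) : @Zl_red m n (x + y) = @Zl_red m n x + @Zl_red m n y.
  rewrite /Zl_red -natrD; apply: val_inj; rewrite [LHS]val_Zp_nat // [RHS]val_Zp_nat //.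
  exact: (modn_dvdm _ dvd).
apply: ex_rmorphism; first move=> x y.
  by apply/eqP; rewrite eq_sym subr_eq -redD subrK.
split=> [|x y]; first by rewrite /Zl_red /= modn_small // Zp_cast.
rewrite /Zl_red -natrM; apply: val_inj; rewrite [LHS]val_Zp_nat // [RHS]val_Zp_nat //.
exact: (modn_dvdm _ dvd).
Qed.

Lemma Zl_red_surj m n (z : 'Z_(l ^ n.+1)) : (n <= m)%N -> exists x, @Zl_red m n x = z.
Proof.
move=> nm; exists (z : nat)%:R; apply: val_inj; rewrite /Zl_red /= !val_Zp_nat //.
rewrite modn_dvdm ?dvdn_exp2l // modn_small //.
by have := ltn_ord z; rewrite [X in (_ < X)%N]Zp_cast.
Qed.

Lemma Zl_red_unit m n (x : 'Z_(l ^ m.+1)) : (n <= m)%N ->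
  (@Zl_red m n x \is a GRing.unit) = (x \is a GRing.unit).
Proof.
move=> nm; rewrite !Zl_unitE /Zl_red val_Zp_nat //.
by rewrite [in LHS]/dvdn modn_dvdm // expnS dvdn_mulr.
Qed.

Lemma Zl_red0 m (x : 'Z_(l ^ m.+1)) : (@Zl_red m 0 x == 0) = (x \isn't a GRing.unit).
Proof. by rewrite Zl_natr_eq0 expn1 Zl_unitE negbK. Qed.

Lemma Zl_mull_eq0 n (x : 'Z_(l ^ n.+2)) : (l%:R * x == 0) = (@Zl_red n.+1 n x == 0).
Proof.
rewrite -[x in LHS]natr_Zp -natrM !Zl_natr_eq0.
by move: (x : nat) => y; rewrite expnS dvdn_pmul2l // prime_gt0.
Qed.

Variable b : nat.
Local Notation V n := 'cV['Z_(l ^ n.+1)]_b.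

Lemma Vl_card n : #|{: V n}| = (l ^ (n.+1 * b))%N.
Proof. by rewrite card_mx muln1 Zl_card -expnM. Qed.

Lemma Vl_red_surj m n (w : V n) : (n <= m)%N ->
  exists v, map_mx (@Zl_red m n) v = w.
Proof.
move=> nm; exists (\matrix_(i, j) (w i j : nat)%:R).
apply/matrixP => i j; rewrite !mxE; apply: val_inj.
rewrite /Zl_red /= !val_Zp_nat // modn_dvdm ?dvdn_exp2l // modn_small //.
by have := ltn_ord (w i j); rewrite [X in (_ < X)%N]Zp_cast.
Qed.

Lemma Vl_card_fiber m n (w : V n) : (n <= m)%N ->
  #|[pred v : V m | map_mx (@Zl_red m n) v == w]| = (l ^ ((m - n) * b))%N.
Proof.
move=> nm; have [f fE] := Zl_redP nm.
have := @card_fiber (V m) (V n) (map_mx (@Zl_red m n)) w _ _.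
rewrite !Vl_card => E; apply/eqP.
rewrite -(eqn_pmul2r (_ : 0 < l ^ (n.+1 * b)))%N; last by rewrite expn_gt0 prime_gt0.
rewrite -expnD -mulnDl addnS subnK // -E //.
  by move=> x z; apply/matrixP => i j; rewrite !mxE -!fE raddfD.
by move=> z; exact: Vl_red_surj.
Qed.

Lemma primitive_red m n (v : V m) : (n <= m)%N ->
  primitive_vec (map_mx (@Zl_red m n) v) = primitive_vec v.
Proof.
by move=> nm; apply: eq_existsb => i; rewrite mxE Zl_red_unit.
Qed.

(** Makes the non-primitive vectors a kernel, hence a subgroup, so that a sum over primitive vectors
    is a difference of two character sums. *)
Lemma primitive_red0 m (v : V m) :
  ~~ primitive_vec v = (map_mx (@Zl_red m 0) v == 0).
Proof.
rewrite negb_exists; apply/forallP/eqP => [v0|v0 i].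
  by apply/matrixP => i j; rewrite !mxE ord1; apply/eqP; rewrite Zl_red0.
by rewrite -Zl_red0; have /matrixP/(_ i 0) := v0; rewrite !mxE => ->.
Qed.

Variable (S : subringClosed K).
Hypothesis l_neq0 : l%:R != 0 :> K.
Local Notation dvl := (dvl S l).

Definition nonprim n : {pred V n} := fun v => ~~ primitive_vec v.
Definition nonunit n : {pred 'Z_(l ^ n.+1)} := fun x => x \isn't a GRing.unit.

Lemma nonunitE n (x : 'Z_(l ^ n.+1)) : (x \in @nonunit n) = (@Zl_red n 0 x == 0).
Proof. by rewrite Zl_red0. Qed.

Lemma nonprimE n (v : V n) : (v \in @nonprim n) = (map_mx (@Zl_red n 0) v == 0).
Proof. by rewrite -primitive_red0. Qed.

Lemma nonunit_zmod n : zmod_closed (@nonunit n).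
Proof.
have [f fE] := Zl_redP (leq0n n).
split=> [|x y]; rewrite !nonunitE -!fE ?raddf0 // => /eqP x0 /eqP y0.
by rewrite raddfB /= x0 y0 subr0.
Qed.

Lemma nonprim_zmod n : zmod_closed (@nonprim n).
Proof.
have [f fE] := Zl_redP (leq0n n).
have E (v : V n) : map_mx (@Zl_red n 0) v = map_mx f v.
  by apply/matrixP => i j; rewrite !mxE fE.
split=> [|x y]; rewrite !nonprimE !E ?raddf0 // => /eqP x0 /eqP y0.
by rewrite raddfB /= x0 y0 subr0.
Qed.

Lemma card_nonprim n : #|@nonprim n| = (l ^ (n * b))%N.
Proof.
have := Vl_card_fiber 0 (leq0n n); rewrite subn0 => <-.
by apply: eq_card => v; rewrite nonprimE inE.
Qed.

Lemma card_nonunit n : #|@nonunit n| = (l ^ n)%N.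
Proof.
have [f fE] := Zl_redP (leq0n n).
have E : (#|@nonunit n| * l = l ^ n * l)%N.
  rewrite -expnSr -[RHS]Zl_card -(@card_fiber 'Z_(l ^ n.+1) 'Z_(l ^ 1) (@Zl_red n 0) 0).
  - congr (_ * _)%N; last by rewrite Zl_card expn1.
    by apply: eq_card => x; rewrite nonunitE inE.
  - by move=> x z; rewrite -!fE raddfD.
  - by move=> z; exact: Zl_red_surj.
by apply/eqP; rewrite -(eqn_pmul2r (prime_gt0 l_pr)) E.
Qed.

Lemma dvl_sum_character (V' : finZmodType) (psi : V' -> K) (H : {pred V'}) N : zmod_closed H ->
  (forall x y, psi (x + y) = psi x * psi y) -> (forall x, psi x != 0) ->
  (l ^ N %| #|H|)%N -> \sum_(x in H) psi x \in dvl N.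
Proof.
move=> HB psiD psi0 NH; have [->|->] := sum_character HB psiD psi0.
  exact: rpred0.
by rewrite dvl_nat.
Qed.

End CharacterSums.

(** * Character sums over fixed primitive vectors *)

Section FixedVectorSums.
Variables (K : fieldType) (l b : nat).

(** A Ramanujan sum when b = 1, Q = 1 and z is a primitive root of order l^n. *)
Definition fixsum n (z : K) (Q : 'M['Z_(l ^ n)]_b) (beta : 'rV['Z_(l ^ n)]_b) : K :=
  \sum_(v : 'cV['Z_(l ^ n)]_b | primitive_vec v && (Q *m v == v))
    z ^+ ((beta *m v) 0 0 : 'Z_(l ^ n)).

Hypothesis l_pr : prime l.
Let expl_gt1 n : (1 < l ^ n.+1)%N := expl_gt1 l_pr n.
Local Hint Resolve expl_gt1 : core.

Section Character.
Variables (n : nat) (z : K).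
Hypothesis z1 : z ^+ (l ^ n.+1) = 1.

Lemma chi_nat m : z ^+ (m%:R : 'Z_(l ^ n.+1)) = z ^+ m.
Proof. by rewrite val_Zp_nat // expr_mod. Qed.

Lemma chiD (x y : 'Z_(l ^ n.+1)) : z ^+ (x + y)%R = z ^+ x * z ^+ y.
Proof. by rewrite -{1}[x]natr_Zp -{1}[y]natr_Zp -natrD chi_nat exprD. Qed.

Lemma chi_neq0 (x : 'Z_(l ^ n.+1)) : z ^+ x != 0.
Proof.
apply: expf_neq0; apply: contra_eq_neq z1 => ->.
by rewrite expr0n expn_eq0 andbC /= -[l == 0%N]negbK -lt0n prime_gt0 //= eq_sym oner_eq0.
Qed.

Lemma chi_sum (I : Type) (r : seq I) (f : I -> 'Z_(l ^ n.+1)) :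
  z ^+ (\sum_(i <- r) f i)%R = \prod_(i <- r) z ^+ f i.
Proof.
elim: r => [|i r IH]; first by rewrite !big_nil.
by rewrite !big_cons chiD IH.
Qed.

Variable S : subringClosed K.
Hypothesis l_neq0 : l%:R != 0 :> K.
Local Notation dvl := (dvl S l).

(** Units are the complement of a subgroup of order l^n in a group of order l^(n+1), and each
    character sum is 0 or the order of the group. Hence the exponent n at level [n.+1]. *)
Lemma dvl_sum_unit (c : 'Z_(l ^ n.+1)) :
  \sum_(u | u \is a GRing.unit) z ^+ (u * c)%R \in dvl n.
Proof.
pose psi (x : 'Z_(l ^ n.+1)) := z ^+ (x * c)%R.
have psiD x y : psi (x + y) = psi x * psi y by rewrite /psi mulrDl chiD.
have psi0 x : psi x != 0 by exact: chi_neq0.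
have -> : \sum_(u | u \is a GRing.unit) z ^+ (u * c)%R =
   \sum_(x in 'Z_(l ^ n.+1)) psi x - \sum_(x in @nonunit l n) psi x.
  rewrite [X in X - _](bigID (fun u => u \is a GRing.unit)) /= -addrA.
  by rewrite [X in _ + X]subrr addr0.
rewrite rpredB //; apply: dvl_sum_character => //.
- by rewrite Zl_card // dvdn_exp2l.
- exact: nonunit_zmod.
- by rewrite card_nonunit.
Qed.

(* A primitive vector is uniquely [u *: w] with [u] a unit and 1 as the first unit
   coordinate of [w], so that the sum splits into Ramanujan sums. *)
Lemma fixsum_dvl (Q : 'M['Z_(l ^ n.+1)]_b) beta : fixsum z Q beta \in dvl n.
Proof.
pose i0 (v : 'cV['Z_(l ^ n.+1)]_b) := [pick i | v i 0 \is a GRing.unit].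
pose c v := if i0 v is Some i then v i 0 else 1.
have cU v : c v \is a GRing.unit.
  by rewrite /c /i0; case: pickP => [i //|_]; rewrite unitr1.
have i0Z u v : u \is a GRing.unit -> i0 (u *: v) = i0 v.
  by move=> uU; apply: eq_pick => i; rewrite mxE unitrMr.
have cZ u v : primitive_vec v -> u \is a GRing.unit -> c (u *: v) = u * c v.
  move=> /existsP[j vj] uU; rewrite /c i0Z // /i0; case: pickP => [i _|/(_ j)].
    by rewrite mxE.
  by rewrite vj.
have primZ u v : u \is a GRing.unit -> primitive_vec (u *: v) = primitive_vec v.
  by move=> uU; apply: eq_existsb => i; rewrite mxE unitrMr.
pose nm v := (c v)^-1 *: v.
pose P v := primitive_vec v && (Q *m v == v).
have PZ u v : u \is a GRing.unit -> P (u *: v) = P v.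
  move=> uU; rewrite /P primZ // -scalemxAr; congr (_ && _).
  apply/eqP/eqP => [/(congr1 (fun w => u^-1 *: w))|-> //].
  by rewrite !scalerA mulVr // !scale1r.
rewrite /fixsum (partition_big nm (fun w => P w && (c w == 1))) /=; last first.
  move=> v; rewrite -/(P v) => Pv.
  rewrite PZ ?unitrV // Pv /= cZ ?unitrV //; first by rewrite mulVr.
  by case/andP: Pv.
apply: rpred_sum => w /andP[Pw /eqP cw].
have /andP[w_prim _] := Pw.
rewrite (reindex_onto (fun u => u *: w) c) /=; last first.
  by move=> v /andP[_ /eqP <-]; rewrite /nm scalerA divrr ?scale1r.
rewrite (eq_bigl (fun u => u \is a GRing.unit)) => [|u].
  rewrite (eq_bigr (fun u => z ^+ (u * ((beta *m w) 0 0))%R)).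
    exact: dvl_sum_unit.
  by move=> u _; rewrite -scalemxAr mxE.
apply/idP/idP => [/andP[_ /eqP <-]//|uU].
by rewrite -/(P _) PZ // Pw /nm cZ // cw mulr1 scalerA mulVr ?scale1r // !eqxx.
Qed.

(** Unless q = 1 no primitive vector is fixed, since its unit coordinate can be cancelled. If q = 1
    all are fixed, and the groups involved have orders l^((n+1)b) and l^(n b). *)
Lemma fixsum_scalar_dvl (q : 'Z_(l ^ n.+1)) beta : fixsum z q%:M beta \in dvl (n * b).
Proof.
rewrite /fixsum.
have [->|q1] := eqVneq q 1; last first.
  rewrite big1 ?rpred0 // => v /andP[/existsP[i vi]].
  rewrite mul_scalar_mx => /eqP/matrixP/(_ i 0); rewrite mxE -{2}[v i 0]mul1r.
  by move/(mulIr vi) => qE; rewrite qE eqxx in q1.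
under eq_bigl do rewrite mul1mx eqxx andbT.
pose psi (v : 'cV['Z_(l ^ n.+1)]_b) := z ^+ ((beta *m v) 0 0 : 'Z_(l ^ n.+1)).
have psiD x y : psi (x + y) = psi x * psi y by rewrite /psi mulmxDr mxE chiD.
have psi0 x : psi x != 0 by exact: chi_neq0.
have -> : \sum_(v | primitive_vec v) psi v =
   \sum_(x in 'cV['Z_(l ^ n.+1)]_b) psi x - \sum_(x in @nonprim l b n) psi x.
  rewrite [X in X - _](bigID (@primitive_vec l b n.+1)) /= -addrA.
  by rewrite [X in _ + X]subrr addr0.
rewrite rpredB //; apply: dvl_sum_character => //.
- by rewrite Vl_card // dvdn_exp2l // leq_mul2r leqnSn orbT.
- exact: nonprim_zmod.
- by rewrite card_nonprim.
Qed.

End Character.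

Hypothesis l_odd : odd l.
Variable n : nat.
Local Notation R1 := 'Z_(l ^ n.+2).
Local Notation red := (@Zl_red l n.+1 n).

Section Lifting.
Variables (P B : 'M[R1]_b).
Hypothesis PE : P = 1%:M + l%:R *: B.

Lemma sum_powers_mod_sq k : exists C : 'M[R1]_b,
  \sum_(i < k) P ^+ i = k%:R%:M + (l * 'C(k, 2))%:R *: B + (l ^ 2)%:R *: C.
Proof.
have PX i : exists C : 'M[R1]_b, P ^+ i = 1%:M + (l * i)%:R *: B + (l ^ 2)%:R *: C.
  elim: i => [|i [C CE]].
    by exists 0; rewrite muln0 scale0r scaler0 !addr0.
  exists (i%:R *: (B * B) + C + l%:R *: (B * C)).
  rewrite exprS CE PE mulnS -!mulmxE !mulmxDl !mul1mx !mulmxDr mulmx1.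
  rewrite -!scalemxAl -!scalemxAr !scalerDr !scalerA !addrA.
  rewrite natrD scalerDl -!natrM !addrA.
  have -> : (l * (l * i) = l ^ 2 * i)%N by rewrite mulnA.
  by rewrite [LHS](ACl (1*4*2*5*3*6)) /= [(l * l ^ 2)%N]mulnC.
elim: k => [|k [C CE]].
  by exists 0; rewrite big_ord0 muln0 scale0r scaler0 !addr0 raddf0.
have [D DE] := PX k; exists (C + D); rewrite big_ord_recr /= CE DE.
rewrite binS bin1 mulnDr natrD scalerDl -natr1 raddfD /= scalerDr !addrA.
by rewrite [LHS](ACl (1*4*2*5*3*6)).
Qed.

(** P^l - 1 is P - 1 times a sum of powers of P, which is l (1 + l D) because l divides 'C(l, 2) for
    odd l; and 1 + l D is invertible, l being nilpotent. *)
Lemma fix_powl (v : 'cV[R1]_b) :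
  (P ^+ l *m v == v) = (l%:R *: ((P - 1%:M) *m v) == 0).
Proof.
have [C CE] := sum_powers_mod_sq l.
have [d dE] : exists d, ('C(l, 2) = d * l)%N.
  by apply/dvdnP; rewrite prime_dvd_bin //= odd_prime_gt2.
pose D := d%:R *: B + C.
have {}CE : \sum_(i < l) P ^+ i = l%:R%:M + (l ^ 2)%:R *: D.
  have ldl : (l * (d * l) = l ^ 2 * d)%N by rewrite mulnC -mulnA mulnC.
  by rewrite CE dE ldl natrM -scalerA -addrA -scalerDr.
set y := (P - 1%:M) *m v.
have -> : (P ^+ l *m v == v) = (l%:R *: y + (l ^ 2)%:R *: (D *m y) == 0).
  rewrite -subr_eq0 -{2}[v]mul1mx -mulmxBl.
  have -> : P ^+ l - 1%:M = (\sum_(i < l) P ^+ i) *m (P - 1%:M).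
    rewrite [LHS]subrX1 mulmxE mulr_suml mulr_sumr; apply: eq_bigr => i _.
    by rewrite mulrBl mulrBr mul1r mulr1 -exprS -exprSr.
  by rewrite -mulmxA -/y CE mulmxDl mul_scalar_mx -scalemxAl.
set z := l%:R *: y.
have -> : (l ^ 2)%:R *: (D *m y) = l%:R *: (D *m z).
  by rewrite /z -scalemxAr scalerA -natrM.
apply/eqP/eqP => [zE|->]; last by rewrite mulmx0 scaler0 addr0.
have {}zE : z = l%:R *: (- D *m z).
  by move/eqP: zE; rewrite addr_eq0 mulNmx scalerN => /eqP.
(* Iterating z = - l D z replaces the inversion of 1 + l D. *)
have E k : z = l%:R ^+ k *: ((- D) ^+ k *m z).
  elim: k => [|k IH]; first by rewrite !expr0 scale1r mul1mx.
  by rewrite {1}IH {1}zE -scalemxAr scalerA -exprSr mulmxA -[_ *m - D]/(_ * - D) -exprSr.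
by rewrite (E n.+2) Zl_natr0 // scale0r.
Qed.

(** For y = (P - 1) v the hypothesis means l y = 0, so P fixes y and P^i v = v + i y. Summing gives
    l v + 'C(l, 2) y, whose second term vanishes. *)
Lemma sum_powers_fix (v : 'cV[R1]_b) : P ^+ l *m v = v ->
  (\sum_(i < l) P ^+ i) *m v = l%:R *: v.
Proof.
move/eqP; rewrite fix_powl; set y := (P - 1%:M) *m v => /eqP ly0.
have Py : P *m y = y by rewrite PE mulmxDl mul1mx -scalemxAl scalemxAr ly0 mulmx0 addr0.
have Pv i : P ^+ i *m v = v + i%:R *: y.
  elim: i => [|i IH]; first by rewrite expr0 mul1mx scale0r addr0.
  rewrite exprS -mulmxE -mulmxA IH mulmxDr -scalemxAr Py -natr1 scalerDl scale1r.
  by rewrite addrA addrAC; congr (_ + _); rewrite /y mulmxBl mul1mx addrC subrK.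
rewrite mulmx_suml (eq_bigr (fun i : 'I_l => v + (i%:R *: y))) => [|i _]; last exact: Pv.
rewrite big_split /= sumr_const card_ord -scaler_suml -natr_sum.
rewrite -(big_mkord xpredT (fun i => i)) bin2_sum [RHS]scaler_nat.
have /dvdnP[d ->] : (l %| 'C(l, 2))%N by rewrite prime_dvd_bin //= odd_prime_gt2.
by rewrite natrM -scalerA ly0 scaler0 addr0.
Qed.

(** Cancelling l in [fix_powl] lowers the modulus from l^(n+2) to l^(n+1); this links the fixed
    vectors of consecutive levels. *)
Lemma fix_red (v : 'cV[R1]_b) :
  (P ^+ l *m v == v) = (map_mx red P *m map_mx red v == map_mx red v).
Proof.
have [f fE] := Zl_redP l_pr (leqnSn n).
have redE m (A : 'M[R1]_(b, m)) : map_mx red A = map_mx f A.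
  by apply/matrixP => i j; rewrite !mxE fE.
rewrite fix_powl !redE -map_mxM -[RHS]subr_eq0 -map_mxB -redE.
have -> : P *m v - v = (P - 1%:M) *m v by rewrite mulmxBl mul1mx.
set y := _ *m v; apply/eqP/eqP => y0; apply/matrixP => i j.
  by have /matrixP/(_ i j) := y0; rewrite !mxE => /eqP; rewrite Zl_mull_eq0 // => /eqP.
by have /matrixP/(_ i j) := y0; rewrite !mxE => /eqP; rewrite -Zl_mull_eq0 // => /eqP.
Qed.

End Lifting.

Lemma chi_red (z : K) (x : R1) : z ^+ (l ^ n.+2) = 1 ->
  (z ^+ l) ^+ red x = z ^+ (l%:R * x)%R.
Proof.
move=> z1; rewrite -{2}[x]natr_Zp -natrM chi_nat // chi_nat ?exprM //.
by rewrite -exprM -expnS.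
Qed.

(** All l^b lifts of a fixed vector are fixed by Q^l ([fix_red]), and on them the exponent acts as l
    beta ([sum_powers_fix]), so the summand is constant on each fibre of the reduction. *)
Lemma fixsum_lift (z : K) (Q B : 'M[R1]_b) (beta : 'rV[R1]_b) :
  z ^+ (l ^ n.+2) = 1 -> Q = 1%:M + l%:R *: B ->
  fixsum z (Q ^+ l) (beta *m \sum_(i < l) Q ^+ i) =
  (l ^ b)%:R * fixsum (z ^+ l) (map_mx red Q) (map_mx red beta).
Proof.
move=> z1 QE; have [f fE] := Zl_redP l_pr (leqnSn n).
have redE m m' (A : 'M[R1]_(m, m')) : map_mx red A = map_mx f A.
  by apply/matrixP => i j; rewrite !mxE fE.
rewrite /fixsum mulr_sumr.
rewrite (partition_big (map_mx red) (fun w => primitive_vec w &&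
   (map_mx red Q *m w == w))) /=; last first.
  by move=> v; rewrite (fix_red QE) primitive_red.
apply: eq_bigr => w /andP[w_prim Qw].
rewrite (eq_bigr (fun=> (z ^+ l) ^+ ((map_mx red beta *m w) 0 0 : 'Z_(l ^ n.+1)))).
  rewrite sumr_const [RHS]mulr_natl; congr (_ *+ _).
  have := Vl_card_fiber l_pr w (leqnSn n); rewrite subSnn mul1n => <-.
  apply: eq_card => v; rewrite !unfold_in /= andbC; case: eqP => //= vw.
  by rewrite (fix_red QE) vw Qw andbT -(primitive_red _ v (leqnSn n)) ?vw.
move=> v /andP[/andP[_ /eqP Qv] /eqP vw].
rewrite -mulmxA (sum_powers_fix QE) // -scalemxAr mxE -chi_red //.
by congr (_ ^+ nat_of_ord _); rewrite -vw !redE -map_mxM [RHS]mxE fE.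
Qed.

End FixedVectorSums.

(** * Traces of products along orbits *)

Lemma block_index k m i t : (i < k)%N -> (t < m)%N ->
  ((k * m).-1 - (i * m + t) = m * (k.-1 - i) + (m.-1 - t))%N.
Proof.
move=> /subnKC <- tm; set d := (k - i.+1)%N.
rewrite addSn /= addKn mulSn mulnDl (mulnC m).
move: (i * m)%N (d * m)%N => x y; lia.
Qed.

Section Words.
Variables (K : fieldType) (A : comNzRingType) (iota : {rmorphism A -> K}).
Variables (l b r : nat).
Hypothesis l_pr : prime l.

Definition orbprod n (F : 'cV['Z_(l ^ n)]_b -> 'M[K]_r) (Q : 'M['Z_(l ^ n)]_b) m v :=
  \prod_(0 <= t < m) F (Q ^+ (m.-1 - t) *m v).

(** The sum T_n(m) of the overview, for an arbitrary matrix-valued function of v. *)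
Definition trsum n (F : 'cV['Z_(l ^ n)]_b -> 'M[K]_r) (Q : 'M['Z_(l ^ n)]_b) m :=
  \sum_(v | primitive_vec v && (Q ^+ m *m v == v)) \tr (orbprod F Q m v).

Lemma orbprod_mul n (F : 'cV['Z_(l ^ n)]_b -> 'M[K]_r) Q m k v :
  orbprod F Q (k * m) v = orbprod (orbprod F Q m) (Q ^+ m) k v.
Proof.
rewrite /orbprod big_nat_mul; apply: eq_big_nat => i /andP[_ ik].
apply: eq_big_nat => t /andP[_ tm]; congr (F _).
rewrite mulmxA mulmxE -exprM -exprD; congr (_ ^+ _ *m _).
by rewrite block_index // addnC.
Qed.

Lemma trsum_mul n (F : 'cV['Z_(l ^ n)]_b -> 'M[K]_r) Q m k :
  trsum F Q (k * m) = trsum (orbprod F Q m) (Q ^+ m) k.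
Proof.
rewrite /trsum mulnC exprM; apply: eq_bigr => v _.
by rewrite mulnC orbprod_mul.
Qed.

Variables (L : finType) (c : L -> A) (E : L -> 'M[K]_r).

(** Abstract form of the truncated F(zeta^v). The alphabet [L] is left arbitrary so that words can
    serve as letters in turn. *)
Definition expsum n (z : K) (alpha : L -> 'rV['Z_(l ^ n)]_b)
    (v : 'cV['Z_(l ^ n)]_b) : 'M[K]_r :=
  \sum_x (iota (c x) * z ^+ ((alpha x *m v) 0 0 : 'Z_(l ^ n))) *: E x.

Definition word_exp n (Q : 'M['Z_(l ^ n)]_b) (alpha : L -> 'rV['Z_(l ^ n)]_b)
    (f : nat -> L) m : 'rV['Z_(l ^ n)]_b :=
  \sum_(0 <= t < m) alpha (f t) *m Q ^+ (m.-1 - t).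
Definition word_coef (f : nat -> L) m : A := \prod_(0 <= t < m) c (f t).
Definition word_mx (f : nat -> L) m : 'M[K]_r := \prod_(0 <= t < m) E (f t).

(** As periodic sequences, words are rotated by a shift of the index, and a power of a word is the
    same sequence read over a greater length. *)
Definition word_ext m (m_gt0 : (0 < m)%N) (w : {ffun 'I_m -> L}) (t : nat) : L :=
  w (Ordinal (ltn_pmod t m_gt0)).

Lemma word_extE m (m_gt0 : (0 < m)%N) w (i : 'I_m) : word_ext m_gt0 w i = w i.
Proof. by congr (w _); apply: val_inj; rewrite /= modn_small. Qed.

Lemma word_ext_period m (m_gt0 : (0 < m)%N) w t : word_ext m_gt0 w (t + m) = word_ext m_gt0 w t.
Proof. by congr (w _); apply: val_inj; rewrite /= modnDr. Qed.

Lemma word_ext_ext m (m_gt0 : (0 < m)%N) f : (forall t, f (t + m)%N = f t) ->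
  word_ext m_gt0 [ffun i : 'I_m => f i] = f.
Proof.
move=> fm; apply: funext => t; rewrite /word_ext ffunE /= {2}(divn_eq t m) addnC.
by elim: (t %/ m)%N => [|k IH]; rewrite ?mul0n ?addn0 // mulSnr addnA fm.
Qed.

Lemma prod_scalemx (I : Type) (s : seq I) (a : I -> K) (M : I -> 'M[K]_r) :
  \prod_(i <- s) (a i *: M i) = (\prod_(i <- s) a i) *: \prod_(i <- s) M i.
Proof.
elim: s => [|i s IH]; first by rewrite !big_nil scale1r.
by rewrite !big_cons IH -mulmxE -scalemxAl -scalemxAr scalerA.
Qed.

Section Level.
Variables (n : nat) (z : K) (Q : 'M['Z_(l ^ n.+1)]_b).
Variable (alpha : L -> 'rV['Z_(l ^ n.+1)]_b).
Hypothesis z1 : z ^+ (l ^ n.+1) = 1.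

Lemma orbprod_expsum m (m_gt0 : (0 < m)%N) v :
  orbprod (expsum z alpha) Q m v =
  \sum_(w : {ffun 'I_m -> L}) (iota (word_coef (word_ext m_gt0 w) m) *
     z ^+ ((word_exp Q alpha (word_ext m_gt0 w) m *m v) 0 0 : 'Z_(l ^ n.+1))) *:
     word_mx (word_ext m_gt0 w) m.
Proof.
rewrite /orbprod big_mkord bigA_distr_bigA; apply: eq_bigr => w _.
rewrite prod_scalemx big_split /= /word_coef /word_mx /word_exp !big_mkord rmorph_prod.
congr ((_ * _) *: _).
- by apply: eq_bigr => i _; rewrite word_extE.
- rewrite mulmx_suml summxE chi_sum //; apply: eq_bigr => i _.
  by rewrite word_extE -mulmxA.
- by apply: eq_bigr => i _; rewrite word_extE.
Qed.

Lemma trsum_expsum m (m_gt0 : (0 < m)%N) :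
  trsum (expsum z alpha) Q m =
  \sum_(w : {ffun 'I_m -> L}) iota (word_coef (word_ext m_gt0 w) m) *
    \tr (word_mx (word_ext m_gt0 w) m) *
    fixsum z (Q ^+ m) (word_exp Q alpha (word_ext m_gt0 w) m).
Proof.
rewrite /trsum (eq_bigr _ (fun v _ => congr1 mxtrace (orbprod_expsum m_gt0 v))).
under eq_bigr do rewrite raddf_sum /=.
rewrite exchange_big; apply: eq_bigr => w _ /=; rewrite /fixsum mulr_sumr.
by apply: eq_bigr => v _; rewrite mxtraceZ mulrAC.
Qed.

Lemma word_exp_rep f m k : (forall t, f (t + m)%N = f t) ->
  word_exp Q alpha f (k * m) = word_exp Q alpha f m *m \sum_(i < k) (Q ^+ m) ^+ i.
Proof.
move=> fm; have fim i t : f (i * m + t)%N = f t.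
  by elim: i => [|i IH]; rewrite ?mul0n // mulSn -addnA addnC fm.
rewrite /word_exp big_nat_mul mulmx_sumr -(big_mkord xpredT (fun i => _ *m (Q ^+ m) ^+ i)).
rewrite [RHS]big_nat_rev /=; apply: eq_big_nat => i /andP[_ ik].
rewrite mulmx_suml; apply: eq_big_nat => t /andP[_ tm].
rewrite fim -mulmxA; congr (_ *m _); rewrite mulmxE -exprM -exprD; congr (_ ^+ _).
by rewrite block_index // addnC add0n; case: k ik => // k _; rewrite subSS.
Qed.

(** The letter that wraps around gets exponent 0 on the left and m on the right, which agree because
    Q^m fixes v. *)
Lemma word_exp_shift f m (v : 'cV_b) : (0 < m)%N -> (forall t, f (t + m)%N = f t) ->
  Q ^+ m *m v = v ->
  word_exp Q alpha (fun t => f t.+1) m *m v = word_exp Q alpha f m *m (Q *m v).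
Proof.
case: m => // m _ fm Qv; rewrite /word_exp big_nat_recr // [in RHS]big_nat_recl //=.
rewrite !mulmxDl addrC; congr (_ + _).
  rewrite subnn subn0 -[m.+1]add0n fm -!mulmxA; congr (_ *m _).
  by rewrite expr0 mul1mx mulmxA mulmxE -exprSr Qv.
rewrite !mulmx_suml; apply: eq_big_nat => i /andP[_ im].
rewrite -!mulmxA; congr (_ *m _); rewrite mulmxA mulmxE -exprSr.
by congr (_ ^+ _ *m _); rewrite subnSK.
Qed.

End Level.

Lemma word_coef_shift f m : (forall t, f (t + m)%N = f t) ->
  word_coef (fun t => f t.+1) m = word_coef f m.
Proof.
case: m => [|m] fm; first by rewrite /word_coef !big_geq.
by rewrite /word_coef big_nat_recr // [in RHS]big_nat_recl //= -[m.+1]add0n fm mulrC.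
Qed.

Lemma tr_wmx_shift f m : (forall t, f (t + m)%N = f t) ->
  \tr (word_mx (fun t => f t.+1) m) = \tr (word_mx f m).
Proof.
case: m => [|m] fm; first by rewrite /word_mx !big_geq.
rewrite /word_mx big_nat_recr // [in RHS]big_nat_recl //= -[m.+1]add0n fm.
by rewrite -!mulmxE mxtrace_mulC.
Qed.

Lemma word_coef_rep f m k : (forall t, f (t + m)%N = f t) ->
  word_coef f (k * m) = word_coef f m ^+ k.
Proof.
move=> fm; have fim i t : f (i * m + t)%N = f t.
  by elim: i => [|i IH]; rewrite ?mul0n // mulSn -addnA addnC fm.
rewrite /word_coef big_nat_mul (eq_bigr (fun=> word_coef f m)).
  by rewrite prodr_const_nat subn0.
by move=> i _; apply: eq_bigr => t _; rewrite fim.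
Qed.

Lemma word_mx_rep f m k : (forall t, f (t + m)%N = f t) ->
  word_mx f (k * m) = word_mx f m ^+ k.
Proof.
move=> fm; have fim i t : f (i * m + t)%N = f t.
  by elim: i => [|i IH]; rewrite ?mul0n // mulSn -addnA addnC fm.
rewrite /word_mx big_nat_mul (eq_bigr (fun=> word_mx f m)).
  by rewrite prodr_const_nat subn0.
by move=> i _; apply: eq_bigr => t _; rewrite fim.
Qed.

(** Closed under products, unlike the matrix units alone, and with traces unchanged by positive
    powers: the matrix part of a word thus needs no congruence. *)
Definition delta_or0 (M : 'M[K]_r) := M = 0 \/ exists i j, M = delta_mx i j.

Lemma delta_or0_mul M M' : delta_or0 M -> delta_or0 M' -> delta_or0 (M *m M').
Proof.
move=> [->|[i [j ->]]]; first by left; rewrite mul0mx.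
move=> [->|[i' [j' ->]]]; first by left; rewrite mulmx0.
rewrite mul_delta_mx_cond; case: eqP => _; last by left.
by right; exists i, j'.
Qed.

Lemma tr_delta_or0 M k : delta_or0 M -> (0 < k)%N -> \tr (M ^+ k) = \tr M.
Proof.
case: k => // k [->|[i [j ->]]] _; first by rewrite expr0n.
elim: k => // k IH; rewrite exprSr exprSr -mulmxE -mulmxA mul_delta_mx_cond.
case: eqP => [_|/eqP ij]; last first.
  by rewrite mulmx0 mxtrace0 /mxtrace big1 // => t _; rewrite mxE;
    case: (t =P i) => //= ->; rewrite eq_sym (negPf ij).
by rewrite mulmxE -exprSr IH.
Qed.

Hypothesis E01 : forall x, delta_or0 (E x).

Lemma word_mx_delta_or0 f m : (0 < m)%N -> delta_or0 (word_mx f m).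
Proof.
case: m => // m _; elim: m => [|m IH]; first by rewrite /word_mx big_nat1.
by rewrite /word_mx big_nat_recr //= -mulmxE; apply: delta_or0_mul.
Qed.

End Words.

(** * Congruence between traces at consecutive levels *)

Section TraceCongruence.
Variables (K : fieldType) (A : comNzRingType) (iota : {rmorphism A -> K}).
Variables (S : subringClosed K) (l b r n : nat).
Hypotheses (l_pr : prime l) (l_odd : odd l) (l_neq0 : l%:R != 0 :> K).
Hypothesis iotaS : forall a, iota a \in S.
Hypothesis iota_Fermat : forall a, iota a ^+ l - iota a \in dvl S l 1.
Variable z : K.
Hypothesis z1 : z ^+ (l ^ n.+2) = 1.
Local Notation R1 := 'Z_(l ^ n.+2).
Local Notation red := (@Zl_red l n.+1 n).
Local Notation dvl := (dvl S l).

Lemma red_map_mxM p q s (M : 'M[R1]_(p, q)) (M' : 'M[R1]_(q, s)) :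
  map_mx red (M *m M') = map_mx red M *m map_mx red M'.
Proof.
have [f fE] := Zl_redP l_pr (leqnSn n).
have redE u v (B : 'M[R1]_(u, v)) : map_mx red B = map_mx f B.
  by apply/matrixP => i j; rewrite !mxE fE.
by rewrite !redE map_mxM.
Qed.

Lemma red_map_mxX (M : 'M[R1]_b) k : map_mx red (M ^+ k) = map_mx red M ^+ k.
Proof.
have [f fE] := Zl_redP l_pr (leqnSn n).
elim: k => [|k IH]; last by rewrite !exprS -!mulmxE red_map_mxM IH.
by rewrite !expr0; apply/matrixP => i j; rewrite !mxE -fE rmorph_nat.
Qed.

Lemma red_map_mx_sum p q (I : Type) (s : seq I) (M : I -> 'M[R1]_(p, q)) :
  map_mx red (\sum_(i <- s) M i) = \sum_(i <- s) map_mx red (M i).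
Proof.
have [f fE] := Zl_redP l_pr (leqnSn n).
apply/matrixP => i j; rewrite !mxE -fE !summxE rmorph_sum.
by apply: eq_bigr => k _; rewrite mxE fE.
Qed.

Lemma primitive_1Dl m (B : 'M['Z_(l ^ m.+1)]_b) (v : 'cV['Z_(l ^ m.+1)]_b) :
  primitive_vec ((1%:M + l%:R *: B) *m v) = primitive_vec v.
Proof.
apply: negb_inj; rewrite !primitive_red0 //; congr (_ == _).
have [f fE] := Zl_redP l_pr (leq0n m).
apply/matrixP => i j; rewrite mulmxDl mul1mx -scalemxAl !mxE -fE rmorphD rmorphM.
rewrite rmorph_nat fE [X in X * _](_ : _ = 0) ?mul0r ?addr0 //.
by apply/eqP; rewrite Zl_natr_eq0 // expn1.
Qed.

Section Power.
Variables (Q B : 'M[R1]_b).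
Hypothesis QE : Q = 1%:M + l%:R *: B.

Lemma power_1Dl k : exists B', Q ^+ k = 1%:M + l%:R *: B'.
Proof.
elim: k => [|k [B' E]]; first by exists 0; rewrite scaler0 addr0.
exists (B + B' + l%:R *: (B *m B')).
rewrite exprS E QE -mulmxE !mulmxDl !mulmxDr !mul1mx mulmx1 -!scalemxAl -!scalemxAr.
by rewrite !scalerDr !addrA; congr (_ + _); rewrite addrAC.
Qed.

Lemma primitive_Q v : primitive_vec (Q *m v) = primitive_vec v.
Proof. by rewrite QE primitive_1Dl. Qed.

Variables (L : finType) (c : L -> A) (E : L -> 'M[K]_r).
Variable alpha : L -> 'rV[R1]_b.
Hypothesis E01 : forall x, delta_or0 (E x).
Local Notation wexp := (@word_exp l b L _ Q alpha).

Lemma fixsum_shift f m : (0 < m)%N -> (forall t, f (t + m)%N = f t) ->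
  fixsum z (Q ^+ m) (wexp (fun t => f t.+1) m) = fixsum z (Q ^+ m) (wexp f m).
Proof.
move=> m_gt0 fm; rewrite /fixsum.
(* On the vectors fixed by Q^m, the inverse of Q is Q^(m-1). *)
rewrite [RHS](reindex_onto (fun v => Q *m v) (fun v => Q ^+ m.-1 *m v)) /=; last first.
  by move=> v /andP[_ /eqP Qv]; rewrite mulmxA mulmxE -exprS prednK.
apply: eq_big => [v|v /andP[_ /eqP Qv]]; last by rewrite word_exp_shift.
rewrite primitive_Q !mulmxA !mulmxE -!exprSr prednK //.
apply/idP/idP => [/andP[-> /eqP Qv] /=|/andP[/andP[-> _] ->] //].
by rewrite Qv eqxx andbT exprS -mulmxE -mulmxA Qv eqxx.
Qed.

Definition word_weight f m : K := iota (word_coef c f m) * \tr (word_mx E f m).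

Lemma word_weight_shift f m : (forall t, f (t + m)%N = f t) ->
  word_weight (fun t => f t.+1) m = word_weight f m.
Proof. by move=> fm; rewrite /word_weight word_coef_shift // tr_wmx_shift. Qed.

Lemma word_weight_in f m : (0 < m)%N -> word_weight f m \in S.
Proof.
move=> m_gt0; rewrite rpredM ?iotaS //.
have [->|[i [j ->]]] := word_mx_delta_or0 E01 f m_gt0; first by rewrite mxtrace0 rpred0.
by rewrite rpred_sum // => k _; rewrite mxE rpred_nat.
Qed.

(** Over length l^(j+i) the coefficient is the l^i-th power of that of one period, while the trace
    is independent of i; Fermat's congruence applies to the coefficient. *)
Lemma word_weight_dvl f j k : (forall t, f (t + l ^ j)%N = f t) ->
  word_weight f (l ^ (j + k.+1)) - word_weight f (l ^ (j + k)) \in dvl k.+1.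
Proof.
move=> fj; have l_gt0 := prime_gt0 l_pr.
have lj : (0 < l ^ j)%N by rewrite expn_gt0 l_gt0.
have E' i : word_weight f (l ^ (j + i)) =
    iota (word_coef c f (l ^ j)) ^+ (l ^ i) * \tr (word_mx E f (l ^ j)).
  rewrite /word_weight addnC expnD word_coef_rep // word_mx_rep // rmorphXn.
  by rewrite tr_delta_or0 ?expn_gt0 ?l_gt0 //; exact: word_mx_delta_or0.
rewrite !E' -mulrBl dvlMr //.
  have [->|[p [q ->]]] := word_mx_delta_or0 E01 f lj; first by rewrite mxtrace0 rpred0.
  by rewrite rpred_sum // => t _; rewrite mxE rpred_nat.
exact: dvl_Fermat.
Qed.

Variable N : nat.
Hypothesis fixN : forall k beta, fixsum z (Q ^+ k) beta \in dvl N.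

(* Both traces are expanded over words. The combined summand [h] is invariant
   under rotation of words of length [l^(s+1)]; a word whose orbit has [l^j]
   elements is a power of a word of length [l^j], and Fermat's congruence for its
   coefficient supplies the missing factor [l^(s+1-j)]. *)
Lemma trsum_dvl_pow s :
  trsum (expsum iota c E z alpha) Q (l ^ s.+1) - (l ^ b)%:R *
    trsum (expsum iota c E (z ^+ l) (fun x => map_mx red (alpha x))) (map_mx red Q) (l ^ s)
  \in dvl (N + s.+1).
Proof.
have l_gt0 := prime_gt0 l_pr.
have m_gt0 : (0 < l ^ s)%N by rewrite expn_gt0 l_gt0.
have M_gt0 : (0 < l ^ s.+1)%N by rewrite expn_gt0 l_gt0.
set m := (l ^ s)%N in m_gt0 *; set M := (l ^ s.+1)%N in M_gt0 *.
have ME : M = (l * m)%N by rewrite /M expnS.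
have mE : m = (l ^ s)%N by [].
have {}MsE : M = (l ^ s.+1)%N by [].
clearbody m M.
pose T := {ffun 'I_M -> L}.
pose e (w : T) := word_ext M_gt0 w.
pose g f := word_weight f m * fixsum z (Q ^+ M) (wexp f M).
pose per (w : T) := `[< forall t, e w (t + m)%N = e w t >].
have zl1 : (z ^+ l) ^+ (l ^ n.+1) = 1 by rewrite -exprM -expnS.
have eM w t : e w (t + M)%N = e w t by exact: word_ext_period.
(* By [fixsum_lift], a word of length m below corresponds to its l-fold repetition above: the lower
   trace becomes a sum over the words of length M with period m. *)
have -> : (l ^ b)%:R * trsum (expsum iota c E (z ^+ l) (fun x => map_mx red (alpha x)))
    (map_mx red Q) m = \sum_(w : T | per w) g (e w).
  rewrite (trsum_expsum iota l_pr c E _ _ zl1 m_gt0) mulr_sumr.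
  rewrite [RHS](reindex_onto
     (fun w' : {ffun 'I_m -> L} => [ffun i : 'I_M => word_ext m_gt0 w' i])
     (fun w => [ffun i : 'I_m => e w i])) /=; last first.
    move=> w /asboolP pw; apply/ffunP => i; rewrite ffunE word_ext_ext //.
    by rewrite /e word_extE.
  have eE w' : e [ffun i : 'I_M => word_ext m_gt0 w' i] = word_ext m_gt0 w'.
    rewrite /e word_ext_ext // => t; rewrite ME mulnC.
    by elim: (l) t => [|k IH] t; rewrite ?muln0 ?addn0 // mulnS addnA IH word_ext_period.
  rewrite [RHS](eq_bigl xpredT) => [|w']; last first.
    rewrite /per eE; apply/andP; split; first by apply/asboolP => t; exact: word_ext_period.
    by apply/eqP/ffunP => i; rewrite ffunE word_extE.
  apply: eq_bigr => w' _; rewrite eE /g mulrCA -/(word_weight _ _); congr (_ * _).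
  have [B' B'E] := power_1Dl m.
  rewrite ME (word_exp_rep _ _ _ (word_ext_period m_gt0 w')) mulnC exprM.
  rewrite (fixsum_lift l_pr l_odd _ z1 B'E) red_map_mxX; congr (_ * fixsum _ _ _).
  rewrite /word_exp red_map_mx_sum; apply: eq_bigr => t _.
  by rewrite red_map_mxM red_map_mxX.
(* Both traces now carry the same [fixsum], which supplies l^N; the difference of weights and the
   orbit length must supply l^(s+1). *)
pose h (w : T) := (word_weight (e w) M - (if per w then word_weight (e w) m else 0)) *
  fixsum z (Q ^+ M) (wexp (e w) M).
have -> : trsum (expsum iota c E z alpha) Q M - \sum_(w : T | per w) g (e w) =
    \sum_w h w.
  rewrite (trsum_expsum iota l_pr c E _ _ z1 M_gt0) [X in _ - X]big_mkcond -sumrB.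
  apply: eq_bigr => w _; rewrite /h mulrBl; congr (_ - _).
  by case: (per w); rewrite ?mul0r.
pose rho (w : T) : T := [ffun i : 'I_M => e w i.+1].
have e_rho w : e (rho w) = (fun t => e w t.+1).
  by rewrite {1}/e /rho (@word_ext_ext _ _ _ (fun t => e w t.+1)) // => t;
    rewrite -addSn; exact: eM.
have e_inj w w' : e w = e w' -> w = w'.
  move=> ee; apply/ffunP => i.
  by rewrite -(word_extE M_gt0 w) -(word_extE M_gt0 w') -/(e w) ee.
have e_iter k w t : e (iter k rho w) t = e w (t + k)%N.
  by elim: k t => [|k IH] t; rewrite ?addn0 //= e_rho IH addnS.
have rho_inj : injective rho.
  move=> u u' /(congr1 e); rewrite !e_rho => ee; apply: e_inj; apply: funext => t.
  have := congr1 (fun h => h (t + M.-1)%N) ee; rewrite /= -!addnS (prednK M_gt0).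
  by rewrite !eM.
apply: (dvl_sum_orbits rho_inj) => w.
  have per_rho : per (rho w) = per w.
    apply/asboolP/asboolP => pw t; last by rewrite e_rho -addSn pw.
    have := pw (t + M.-1)%N; rewrite e_rho -[(t + M.-1).+1]addnS (prednK M_gt0) eM => <-.
    by rewrite addnAC -addnS (prednK M_gt0) eM.
  rewrite /h per_rho e_rho (fixsum_shift M_gt0 (eM w)) (word_weight_shift (eM w)).
  congr ((_ - _) * _); have [pw|//] := boolP (per w).
  exact: (word_weight_shift (asboolW pw)).
have : (order rho w %| l ^ s.+1)%N.
  rewrite -MsE; apply: dvdn_order => //; apply: e_inj; apply: funext => t.
  by rewrite e_iter eM.
case/(dvdn_pfactor _ _ l_pr) => j js oE.
have ej t : e w (t + l ^ j)%N = e w t.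
  by rewrite -e_iter -oE iter_order.
rewrite /h mulrA [(N + _)%N]addnC; apply: dvlMM (fixN _ _); rewrite oE.
(* In an orbit of full length l^(s+1), the length suffices and the weights need only lie in [S]. *)
move: js; rewrite leq_eqVlt => /orP[/eqP ->|].
  apply: dvlMr; last exact: dvl_nat.
  apply: rpredB; first exact: word_weight_in.
  by case: (per w); [exact: word_weight_in|exact: rpred0].
(* In a shorter orbit l^j divides m, so both weights occur; their difference supplies l^(s+1-j). *)
rewrite ltnS => js; rewrite ifT; last first.
  apply/asboolP => t; rewrite mE -(subnKC js) expnD mulnC.
  by elim: (l ^ _)%N t => [|k IH] t; rewrite ?mul0n ?addn0 // mulSn addnA IH ej.
rewrite MsE mE -(subnKC js) -addnS; apply: dvlMM; first exact: dvl_nat.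
exact: word_weight_dvl.
Qed.

End Power.
End TraceCongruence.

Section TraceCongruenceGeneral.
Variables (K : fieldType) (A : comNzRingType) (iota : {rmorphism A -> K}).
Variables (S : subringClosed K) (l b r n : nat).
Hypotheses (l_pr : prime l) (l_odd : odd l) (l_neq0 : l%:R != 0 :> K).
Hypothesis iotaS : forall a, iota a \in S.
Hypothesis iota_Fermat : forall a, iota a ^+ l - iota a \in dvl S l 1.
Variable z : K.
Hypothesis z1 : z ^+ (l ^ n.+2) = 1.
Local Notation R1 := 'Z_(l ^ n.+2).
Local Notation red := (@Zl_red l n.+1 n).
Variables (Q B : 'M[R1]_b).
Hypothesis QE : Q = 1%:M + l%:R *: B.
Variables (L : finType) (c : L -> A) (E : L -> 'M[K]_r).
Variable alpha : L -> 'rV[R1]_b.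
Hypothesis E01 : forall x, delta_or0 (E x).
Variable N : nat.
Hypothesis fixN : forall k beta, fixsum z (Q ^+ k) beta \in dvl S l N.

(** Words whose length is the prime-to-l part m' of m become the letters, with Q^m' in place of Q
    and a power of l in place of m; the valuation of l m is unchanged. *)
Lemma trsum_dvl m : (0 < m)%N ->
  trsum (expsum iota c E z alpha) Q (l * m) - (l ^ b)%:R *
    trsum (expsum iota c E (z ^+ l) (fun x => map_mx red (alpha x))) (map_mx red Q) m
  \in dvl S l (N + logn l (l * m)).
Proof.
move=> m_gt0; have [m' co_lm' mE] := pfactor_coprime l_pr m_gt0.
have m'_gt0 : (0 < m')%N by move: m_gt0; rewrite mE muln_gt0 => /andP[].
rewrite lognM ?(prime_gt0 l_pr) // (logn_prime l l_pr) eqxx add1n.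
move: (logn l m) mE => e ->.
have zl1 : (z ^+ l) ^+ (l ^ n.+1) = 1 by rewrite -exprM -expnS.
have -> : (l * (m' * l ^ e) = l ^ e.+1 * m')%N by rewrite expnS mulnCA mulnC.
rewrite [(m' * _)%N]mulnC !trsum_mul.
pose L' := {ffun 'I_m' -> L}.
pose c' (w : L') := word_coef c (word_ext m'_gt0 w) m'.
pose E' (w : L') := word_mx E (word_ext m'_gt0 w) m'.
pose alpha' (w : L') := word_exp Q alpha (word_ext m'_gt0 w) m'.
have -> : orbprod (expsum iota c E z alpha) Q m' = expsum iota c' E' z alpha'.
  by apply: funext => v; rewrite (orbprod_expsum iota l_pr c E _ _ z1 m'_gt0).
have -> : orbprod (expsum iota c E (z ^+ l) (fun x => map_mx red (alpha x)))
    (map_mx red Q) m' = expsum iota c' E' (z ^+ l) (fun w => map_mx red (alpha' w)).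
  apply: funext => v; rewrite (orbprod_expsum iota l_pr c E _ _ zl1 m'_gt0).
  apply: eq_bigr => w _; congr ((_ * _ ^+ nat_of_ord ((_ *m _) 0 0)) *: _).
  rewrite /alpha' /word_exp red_map_mx_sum //; apply: eq_bigr => t _.
  by rewrite red_map_mxM // red_map_mxX.
rewrite -red_map_mxX //; have [B' QE'] := power_1Dl QE m'.
apply: (trsum_dvl_pow l_pr l_odd l_neq0 iotaS iota_Fermat z1 QE').
  by move=> w; exact: word_mx_delta_or0.
by move=> k beta; rewrite -exprM.
Qed.

End TraceCongruenceGeneral.

(** * From traces to products over orbits *)

Section Orbits.
Variables (K : fieldType) (l b r n : nat).
Local Notation V := 'cV['Z_(l ^ n)]_b.
Variable Q : 'M['Z_(l ^ n)]_b.
Hypothesis Q_inj : injective (fun v : V => Q *m v).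
Hypothesis Q_prim : forall v : V, primitive_vec (Q *m v) = primitive_vec v.
Local Notation sigma := (fun v : V => Q *m v).

Lemma iter_mulmx k v : iter k sigma v = Q ^+ k *m v.
Proof.
elim: k => [|k IH]; first by rewrite expr0 mul1mx.
by rewrite iterS IH exprS -mulmxE mulmxA.
Qed.

Lemma mulmx_exprSr k (v : V) : Q ^+ k *m (Q *m v) = Q ^+ k.+1 *m v.
Proof. by rewrite mulmxA mulmxE -exprSr. Qed.

Lemma fix_order k v : (Q ^+ k *m v == v) = (order sigma v %| k)%N.
Proof.
apply/eqP/dvdnP => [|[d ->]]; first by rewrite -iter_mulmx => /(dvdn_order Q_inj)/dvdnP.
rewrite -iter_mulmx mulnC; elim: d => [|d IH]; first by rewrite muln0.
by rewrite mulnS iterD IH iter_order.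
Qed.

Variable X : {set V}.
Hypothesis X_prim : forall v, v \in X -> primitive_vec v.
Hypothesis X_repr : forall v, primitive_vec v ->
  exists! x, x \in X /\ exists k, x = Q ^+ k *m v.

Lemma sum_primitive (h : V -> K) : (forall v, h (Q *m v) = h v) ->
  \sum_(v | primitive_vec v) h v = \sum_(x in X) h x *+ order sigma x.
Proof.
move=> hQ; have primX k v : primitive_vec (iter k sigma v) = primitive_vec v.
  by elim: k => //= k IH; rewrite Q_prim.
transitivity (\sum_(v | primitive_vec v) \sum_(x | (x \in X) && fconnect sigma x v) h v).
  apply: eq_bigr => v v_prim; have [x [[xX [k xE]] x_uniq]] := X_repr v_prim.
  rewrite (big_pred1 x) // => y; apply/andP/eqP => [[yX yv]|->]; last first.
    by split=> //; rewrite fconnect_sym // xE -iter_mulmx fconnect_iter.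
  apply/esym/x_uniq; split => //; exists (findex sigma v y).
  by rewrite -iter_mulmx iter_findex // fconnect_sym.
rewrite (exchange_big_dep (fun x => x \in X)) /=; last by move=> v x _ /andP[].
apply: eq_bigr => x xX; rewrite -sum_orbit //; apply: eq_bigl => v; rewrite xX /=.
by apply/andb_idl => /iter_findex <-; rewrite primX X_prim.
Qed.

Variable F : V -> 'M[K]_r.

Lemma tr_orbprod_shift m v : Q ^+ m *m v = v ->
  \tr (orbprod F Q m (Q *m v)) = \tr (orbprod F Q m v).
Proof.
case: m => [|m] Qv; first by rewrite /orbprod !big_geq.
rewrite /orbprod big_nat_recl // [in RHS]big_nat_recr //= -!mulmxE mxtrace_mulC.
rewrite subn0 subnn mulmx_exprSr Qv expr0 mul1mx; congr (\tr (_ * _)).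
apply: eq_big_nat => i /andP[_ im].
by rewrite mulmx_exprSr subnSK.
Qed.

Lemma orbprod_rep m k v : Q ^+ m *m v = v ->
  orbprod F Q (k * m) v = orbprod F Q m v ^+ k.
Proof.
move=> Qv; rewrite orbprod_mul {1}/orbprod.
rewrite (eq_bigr (fun=> orbprod F Q m v)); first by rewrite prodr_const_nat subn0.
move=> i _; congr (orbprod F Q m _); elim: (_ - i)%N => [|d IH].
  by rewrite expr0 mul1mx.
by rewrite exprSr -mulmxE -mulmxA Qv IH.
Qed.

Variable k : nat.
Hypothesis k_gt0 : (0 < k)%N.
Hypothesis k_dvd : forall v, primitive_vec v -> (k %| order sigma v)%N.

Definition orbpoly : {poly K} := \prod_(v in X)
  (\det (1%:M - 'X *: map_mx polyC (orbprod F Q (order sigma v) v))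
    \Po 'X^(order sigma v %/ k)).

(** An orbit of length o = c k contributes c tr(A^(j/c)) when c divides j. Multiplied by k, this is
    the sum over its o points of the traces of products of length j k, which are invariant under
    rotation. *)
Lemma logder_orbpoly : exists2 t, logder orbpoly t &
  forall j, (0 < j)%N -> k%:R * t j = trsum F Q (j * k).
Proof.
eexists.
  apply: logder_prod => v vX; apply: logder_compXn; last exact: logder_det.
  by rewrite divn_gt0 // dvdn_leq ?order_gt0 // k_dvd // X_prim.
move=> j j_gt0 /=.
pose h (v : V) := if Q ^+ (j * k) *m v == v then \tr (orbprod F Q (j * k) v) else 0.
have hQ v : h (Q *m v) = h v.
  rewrite /h; have -> : (Q ^+ (j * k) *m (Q *m v) == Q *m v) = (Q ^+ (j * k) *m v == v).
    by rewrite mulmx_exprSr exprS -mulmxE -mulmxA (inj_eq Q_inj).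
  by case: eqP => // /tr_orbprod_shift.
rewrite /trsum [RHS]big_mkcondr [RHS](sum_primitive hQ) mulr_sumr.
apply: eq_bigr => v vX; have kv := k_dvd (X_prim vX); set o := order _ v in kv *.
have o_gt0 : (0 < o)%N by exact: order_gt0.
have oE : o = (o %/ k * k)%N by rewrite divnK.
have c_gt0 : (0 < o %/ k)%N by rewrite divn_gt0 // dvdn_leq.
have oj : (o %| j * k)%N = (o %/ k %| j)%N by rewrite {1}oE dvdn_pmul2r.
rewrite /h fix_order -/o oj.
case: ifP => [cj|_]; last by rewrite mulr0 mul0rn.
rewrite divn_gt0 // dvdn_leq // mul1r mulrA -natrM [(k * _)%N]mulnC divnK //.
rewrite mulr_natl; congr (\tr _ *+ _).
rewrite -orbprod_rep; last by apply/eqP; rewrite fix_order.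
by rewrite {2}oE mulnA divnK.
Qed.

Lemma coef0_orbpoly : orbpoly`_0 = 1.
Proof.
rewrite -horner_coef0 /orbpoly horner_prod big1 // => v vX.
rewrite horner_comp hornerXn expr0n gtn_eqF; first by rewrite horner_coef0 coef0_det.
by rewrite divn_gt0 // dvdn_leq ?order_gt0 // k_dvd // X_prim.
Qed.

End Orbits.

(** * Reduction to truncated power series *)

Section IdealCongruence.
Variables (R : comNzRingType) (P : subringClosed R) (I : zmodClosed R).
Hypothesis I_ideal : forall a x, a \in P -> x \in I -> a * x \in I.

(** Membership in [P] is part of the relation because [I] absorbs multiplication by elements of [P]
    only; this makes products compatible. *)
Definition eqmodI (x y : R) := [/\ x \in P, y \in P & x - y \in I].

Lemma eqmodI_refl x : x \in P -> eqmodI x x.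
Proof. by move=> Px; split; rewrite ?subrr ?rpred0. Qed.

Lemma eqmodID x y x' y' : eqmodI x y -> eqmodI x' y' -> eqmodI (x + x') (y + y').
Proof.
move=> [Px Py xy] [Px' Py' xy']; split; [exact: rpredD|exact: rpredD|].
by rewrite opprD addrACA rpredD.
Qed.

Lemma eqmodIM x y x' y' : eqmodI x y -> eqmodI x' y' -> eqmodI (x * x') (y * y').
Proof.
move=> [Px Py xy] [Px' Py' xy']; split; [exact: rpredM|exact: rpredM|].
have -> : x * x' - y * y' = x' * (x - y) + y * (x' - y') by ring.
by rewrite rpredD // I_ideal.
Qed.

Lemma eqmodI_sum (T : Type) (s : seq T) (Q : pred T) (f g : T -> R) :
  (forall i, Q i -> eqmodI (f i) (g i)) ->
  eqmodI (\sum_(i <- s | Q i) f i) (\sum_(i <- s | Q i) g i).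
Proof.
move=> fg; apply: (big_ind2 eqmodI) => //; last by move=> *; exact: eqmodID.
by apply: eqmodI_refl; exact: rpred0.
Qed.

Lemma eqmodI_prod (T : Type) (s : seq T) (Q : pred T) (f g : T -> R) :
  (forall i, Q i -> eqmodI (f i) (g i)) ->
  eqmodI (\prod_(i <- s | Q i) f i) (\prod_(i <- s | Q i) g i).
Proof.
move=> fg; apply: (big_ind2 eqmodI) => //; last by move=> *; exact: eqmodIM.
by apply: eqmodI_refl; exact: rpred1.
Qed.

Lemma eqmodI_det n (A B : 'M[R]_n) :
  (forall i j, eqmodI (A i j) (B i j)) -> eqmodI (\det A) (\det B).
Proof.
move=> AB; apply: eqmodI_sum => s _; apply: eqmodIM; last exact: eqmodI_prod.
by apply: eqmodI_refl; rewrite rpredX // rpredN1.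
Qed.

Lemma eqmodI_mulmx m n p (A A' : 'M[R]_(m, n)) (B B' : 'M[R]_(n, p)) :
  (forall i j, eqmodI (A i j) (A' i j)) -> (forall i j, eqmodI (B i j) (B' i j)) ->
  forall i j, eqmodI ((A *m B) i j) ((A' *m B') i j).
Proof.
by move=> AA' BB' i j; rewrite !mxE; apply: eqmodI_sum => k _; exact: eqmodIM.
Qed.

End IdealCongruence.

Section PolyOverSubring.
Variables (R : nzRingType) (S : subringClosed R) (I : zmodClosed R).

Definition polyOver_sub : {pred {poly R}} := fun p => p \is a polyOver S.
Definition polyOver_ideal : {pred {poly R}} := fun p => p \is a polyOver I.

Fact polyOver_subring : subring_closed polyOver_sub.
Proof.
split=> [|p q|p q]; rewrite !unfold_in -!/(_ \is a polyOver S).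
- exact: rpred1.
- move=> Sp Sq; apply/polyOverP => i.
  by rewrite coefB rpredB ?(polyOverP Sp) ?(polyOverP Sq).
- exact: rpredM.
Qed.
HB.instance Definition _ :=
  GRing.isSubringClosed.Build {poly R} polyOver_sub polyOver_subring.

Fact polyOver_ideal_zmod : zmod_closed polyOver_ideal.
Proof.
split=> [|p q]; rewrite !unfold_in -!/(_ \is a polyOver I); first exact: rpred0.
move=> Ip Iq; apply/polyOverP => i.
by rewrite coefB rpredB ?(polyOverP Ip) ?(polyOverP Iq).
Qed.
HB.instance Definition _ :=
  GRing.isZmodClosed.Build {poly R} polyOver_ideal polyOver_ideal_zmod.

End PolyOverSubring.

Section OrbitPolynomialCongruence.
Variables (K : fieldType) (S : subringClosed K) (l b r n N : nat).
Local Notation eqS := (eqmodI S (dvl S l N)).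
Local Notation eqP := (eqmodI (polyOver_sub S) (polyOver_ideal (dvl S l N))).

Lemma eqmod_polyP p q : eqP p q <->
  [/\ p \is a polyOver S, q \is a polyOver S & p - q \is a polyOver (dvl S l N)].
Proof. by []. Qed.

Lemma polyOver_idealM (p q : {poly K}) : p \in polyOver_sub S ->
  q \in polyOver_ideal (dvl S l N) -> p * q \in polyOver_ideal (dvl S l N).
Proof.
move=> Sp Nq; apply/polyOverP => i; rewrite coefM rpred_sum // => j _.
by rewrite dvlMl // ?(polyOverP Sp) // (polyOverP Nq).
Qed.

Lemma eqmod_polyC x y : eqS x y -> eqP x%:P y%:P.
Proof. by case=> Sx Sy xy; apply/eqmod_polyP; rewrite -polyCB !polyOverC. Qed.

Lemma eqmod_compXn p q c : (0 < c)%N -> eqP p q -> eqP (p \Po 'X^c) (q \Po 'X^c).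
Proof.
move=> c_gt0 /eqmod_polyP[Sp Sq pq]; apply/eqmod_polyP; split.
- by rewrite polyOver_comp // rpredX // polyOverX.
- by rewrite polyOver_comp // rpredX // polyOverX.
rewrite -comp_polyB; apply/polyOverP => i; rewrite coef_comp_poly_Xn //.
by case: ifP => _; rewrite ?rpred0 // (polyOverP pq).
Qed.

Variables (Q : 'M['Z_(l ^ n)]_b) (F F' : 'cV['Z_(l ^ n)]_b -> 'M[K]_r).
Hypothesis FF' : forall v i j, eqS (F v i j) (F' v i j).

Lemma eqmod_orbprod m v i j : eqS (orbprod F Q m v i j) (orbprod F' Q m v i j).
Proof.
have idl a x : a \in S -> x \in dvl S l N -> a * x \in dvl S l N by exact: dvlMl.
rewrite /orbprod; move: i j; apply: (big_ind2 (fun A B : 'M[K]_r =>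
    forall i j, eqS (A i j) (B i j))) => //.
  by move=> i j; apply: eqmodI_refl; rewrite mxE rpred_nat.
by move=> A A' B B' AA' BB' i j; apply: eqmodI_mulmx.
Qed.

Lemma eqmod_orbpoly (X : {set 'cV['Z_(l ^ n)]_b}) k : (0 < k)%N ->
  (forall v, v \in X -> (k %| order (fun v => Q *m v) v)%N) ->
  eqP (orbpoly Q X F k) (orbpoly Q X F' k).
Proof.
move=> k_gt0 k_dvd; apply: eqmodI_prod => [|v vX]; first exact: polyOver_idealM.
apply: eqmod_compXn; first by rewrite divn_gt0 // dvdn_leq ?order_gt0 // k_dvd.
apply: eqmodI_det => [|i j]; first exact: polyOver_idealM.
rewrite !mxE; apply: eqmodID; first by apply: eqmodI_refl; rewrite rpred_nat.
rewrite -!mulNr; apply: eqmodIM; first exact: polyOver_idealM.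
  by apply: eqmodI_refl; rewrite rpredN; exact: polyOverX.
by apply: eqmod_polyC; exact: eqmod_orbprod.
Qed.

End OrbitPolynomialCongruence.

(** * Arithmetic of the l-adic integers *)

Section PadicIntegers.
Variable l : nat.
Hypothesis l_pr : prime l.
Local Notation p := (padic_base l).
Implicit Types x y : padic l.

Lemma padic_addE x y n : (x + y)%R n = ((x n + y n) %% p ^ n)%N.
Proof. by []. Qed.

Lemma padic_mulE x y n : (x * y)%R n = ((x n * y n) %% p ^ n)%N.
Proof. by []. Qed.

Lemma padic_natE m n : (m%:R : padic l) n = (m %% p ^ n)%N.
Proof.
elim: m => [|m IH]; first by [].
rewrite -natr1 padic_addE IH -[padic_res 1 n]/(1 %% p ^ n)%N.
by rewrite modnDml modnDmr addn1.
Qed.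

Lemma padic_expE x k n : (x ^+ k) n = (x n ^ k %% p ^ n)%N.
Proof.
elim: k => [|k IH]; first by rewrite expr0 (padic_natE 1).
by rewrite exprS padic_mulE IH modnMmr expnS.
Qed.

Lemma padic_res_leq x m n : (n <= m)%N -> (x m %% p ^ n)%N = x n.
Proof.
move=> /subnKC <-; elim: (m - n)%N => [|k IH]; first by rewrite addn0 padic_mod.
by rewrite -[RHS]IH addnS (padic_resP x (n + k)) modn_dvdm // dvdn_exp2l // leq_addr.
Qed.

(** Division by l^n shifts the digits: y modulo l^k is read off from x modulo l^(k+n). *)
Lemma padic_dvd_res0 x n : x n = 0%N -> exists y, x = (l ^ n)%:R * y.
Proof.
move=> xn0; have lE : (l ^ n = p ^ n)%N by rewrite (padic_baseE l_pr).
have y_res k : (x (k + n) %/ p ^ n = (x (k.+1 + n) %/ p ^ n) %% p ^ k)%N.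
  by rewrite modn_divl -expnD padic_res_leq // addSn leqW.
exists (Padic y_res); apply: padic_eq => k; rewrite padic_mulE padic_natE modnMml lE /=.
have /divnK : (p ^ n %| x (k + n))%N by rewrite /dvdn padic_res_leq ?leq_addl ?xn0.
by rewrite mulnC => ->; rewrite padic_res_leq // leq_addr.
Qed.

Lemma padic_dvd_sub x y n : x n = y n -> exists d, x - y = (l ^ n)%:R * d.
Proof.
move=> xy; apply: padic_dvd_res0; apply/eqP; rewrite -(padic_mod (x - y)).
rewrite -[0%N](mod0n (p ^ n)) -(eqn_modDr (y n)) -padic_addE subrK add0n padic_mod.
by rewrite xy.
Qed.

Lemma padic_Fermat x : exists d, x ^+ l - x = l%:R * d.
Proof.
have [|d ->] := @padic_dvd_sub (x ^+ l) x 1; last by exists d; rewrite expn1.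
rewrite padic_expE -[RHS]padic_mod expn1 (padic_baseE l_pr); exact: fermat_little.
Qed.

(** The limit is the diagonal [s k k], since modulo l^k the sequence is constant from index k on. *)
Lemma padic_limit (s : nat -> padic l) :
  (forall k, exists c, s k.+1 - s k = (l ^ k)%:R * c) ->
  exists x, forall k, exists c, x - s k = (l ^ k)%:R * c.
Proof.
move=> s_cauchy; have s_res k : s k.+1 k = s k k.
  have [c] := s_cauchy k; move/eqP; rewrite subr_eq => /eqP ->.
  have lE : (l ^ k = p ^ k)%N by rewrite (padic_baseE l_pr).
  by rewrite padic_addE padic_mulE padic_natE lE modnn mul0n mod0n add0n padic_mod.
have x_res k : (s k k = s k.+1 k.+1 %% p ^ k)%N by rewrite padic_res_leq.
by exists (Padic x_res) => k; exact: padic_dvd_sub.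
Qed.

Lemma padic_mx_1Dl b (Q : 'M[padic l]_b) : map_mx (@padic_modl l) Q = 1%:M ->
  exists B, Q = 1%:M + l%:R *: B.
Proof.
move=> Q1; have Q1' i j : exists d, Q i j - (i == j)%:R = l%:R * d.
  have /matrixP/(_ i j) := Q1; rewrite !mxE => /(congr1 (fun x : 'F_l => x : nat)).
  rewrite /padic_modl !val_Fp_nat // => Qij.
  have [|d ->] := @padic_dvd_sub (Q i j) (i == j)%:R 1; last by exists d; rewrite expn1.
  by rewrite padic_natE -padic_mod expn1 (padic_baseE l_pr).
exists (\matrix_(i, j) projT1 (cid (Q1' i j))); apply/matrixP => i j; rewrite !mxE.
by case: cid => d /= <-; rewrite addrC subrK.
Qed.

Lemma padic_modnP n :
  exists f : {rmorphism padic l -> 'Z_(l ^ n.+1)}, f =1 @padic_modn l n.+1.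
Proof.
have l1 : (1 < l ^ n.+1)%N by exact: expl_gt1.
have modD x y : padic_modn n.+1 (x + y) = padic_modn n.+1 x + padic_modn n.+1 y.
  rewrite /padic_modn -natrD padic_addE (padic_baseE l_pr).
  by apply: val_inj; rewrite [LHS]val_Zp_nat // [RHS]val_Zp_nat // modn_mod.
apply: ex_rmorphism; first by move=> x y; apply/eqP; rewrite eq_sym subr_eq -modD subrK.
split=> [|x y]; rewrite /padic_modn.
  by rewrite (padic_natE 1) modn_small // (padic_baseE l_pr).
rewrite -natrM padic_mulE (padic_baseE l_pr).
by apply: val_inj; rewrite [LHS]val_Zp_nat // [RHS]val_Zp_nat // modn_mod.
Qed.

End PadicIntegers.

(** * Completeness of Z_l[z] *)

Section Adjoin.
Variables (l : nat) (K : fieldType) (iota : {rmorphism padic l -> K}) (z : K).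

Definition adjoin : {pred K} := fun x => `[< in_adjoin iota z x >].

Lemma adjoinP x : reflect (in_adjoin iota z x) (x \in adjoin).
Proof. exact: asboolP. Qed.

Fact adjoin_subring : subring_closed adjoin.
Proof.
split=> [|x y /adjoinP[P ->] /adjoinP[P' ->]|x y /adjoinP[P ->] /adjoinP[P' ->]];
  apply/adjoinP.
- by exists 1; rewrite rmorph1 hornerC.
- by exists (P - P'); rewrite rmorphB hornerD hornerN.
- by exists (P * P'); rewrite rmorphM hornerM.
Qed.
HB.instance Definition _ := GRing.isSubringClosed.Build K adjoin adjoin_subring.

Lemma adjoin_iota a : iota a \in adjoin.
Proof. by apply/adjoinP; exists a%:P; rewrite map_polyC hornerC. Qed.

Lemma adjoin_gen : z \in adjoin.
Proof. by apply/adjoinP; exists 'X; rewrite map_polyX hornerX. Qed.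

Hypothesis l_neq0 : l%:R != 0 :> K.

Lemma adjoin_eqmodP N x y : adjoin_eqmod iota z N x y <-> x - y \in dvl adjoin l N.
Proof.
split=> [[c /adjoinP Sc E]|/(dvlP _ l_neq0)[c /adjoinP Sc E]].
  by apply/(dvlP _ l_neq0); exists c; rewrite // E natrX.
by exists c; rewrite // natrX.
Qed.

Variable H : nat.
Hypotheses (H_gt0 : (0 < H)%N) (zH : z ^+ H = 1).

Lemma adjoin_coords x : x \in adjoin ->
  exists c : 'I_H -> padic l, x = \sum_j iota (c j) * z ^+ j.
Proof.
case/adjoinP => P ->; pose m (i : nat) : 'I_H := Ordinal (ltn_pmod i H_gt0).
exists (fun j => \sum_(i < size P | m i == j) P`_i).
rewrite horner_poly (partition_big (fun i : 'I_(size P) => m i) xpredT) //=.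
apply: eq_bigr => j _; rewrite rmorph_sum mulr_suml; apply: eq_bigr => i /eqP <-.
by rewrite /= expr_mod.
Qed.

Hypothesis l_pr : prime l.

(** The powers of z below H span Z_l[z] over Z_l. Coordinates are chosen for each increment and
    summed in Z_l. *)
Lemma adjoin_complete (U : nat -> K) : U 0%N \in adjoin ->
  (forall k, U k.+1 - U k \in dvl adjoin l k) ->
  exists2 x, x \in adjoin & forall k, x - U k \in dvl adjoin l k.
Proof.
move=> U0 UP.
have cP k : exists c : 'I_H -> padic l,
    U k.+1 - U k = l%:R ^+ k * \sum_j iota (c j) * z ^+ j.
  by have /(dvlP _ l_neq0)[y /adjoin_coords[c ->] ->] := UP k; exists c.
pose c k := projT1 (cid (cP k)).
have cE k : U k.+1 - U k = l%:R ^+ k * \sum_j iota (c k j) * z ^+ j.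
  by rewrite /c; case: cid.
pose s j k := \sum_(i < k) (l ^ i)%:R * c i j.
have sP j k : exists d, s j k.+1 - s j k = (l ^ k)%:R * d.
  by exists (c k j); rewrite /s big_ord_recr /= addrAC subrr add0r.
have xP j := padic_limit l_pr (sP j).
pose x j := projT1 (cid (xP j)).
have xE j k : exists d, x j - s j k = (l ^ k)%:R * d by rewrite /x; case: cid.
have UE k : U k = U 0%N + \sum_j iota (s j k) * z ^+ j.
  elim: k => [|k IH].
    by rewrite big1 ?addr0 // => j _; rewrite /s big_ord0 rmorph0 mul0r.
  rewrite -(subrK (U k) (U k.+1)) cE {1}IH addrC -addrA; congr (_ + _).
  rewrite mulr_sumr -big_split /=; apply: eq_bigr => j _.
  by rewrite /s big_ord_recr /= rmorphD mulrDl rmorphM rmorph_nat natrX mulrA.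
exists (U 0%N + \sum_j iota (x j) * z ^+ j).
  rewrite rpredD // rpred_sum // => j _.
  by rewrite rpredM ?adjoin_iota // rpredX // adjoin_gen.
move=> k; rewrite (UE k) opprD addrACA subrr add0r -sumrB.
apply: rpred_sum => j _; rewrite -mulrBl -rmorphB.
have [d ->] := xE j k; rewrite rmorphM rmorph_nat.
by rewrite dvlMr ?rpredX ?adjoin_gen // dvlMr ?adjoin_iota // dvl_nat.
Qed.

End Adjoin.

(** * Convergence of power series at the points z^a - 1 *)

Section FrobeniusPower.
Variables (K : fieldType) (S : subringClosed K) (l : nat).
Hypotheses (l_pr : prime l) (l_odd : odd l) (l_neq0 : l%:R != 0 :> K).
Local Notation dvl := (dvl S l).

Lemma dvl_subr1_exp x : x \in S -> (x - 1) ^+ l - (x ^+ l - 1) \in dvl 1.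
Proof.
move=> Sx; rewrite exprDn -(big_mkord xpredT (fun i => x ^+ (l - i) * (-1) ^+ i *+ 'C(l, i))).
rewrite big_nat_recr //= big_ltn ?prime_gt0 //.
rewrite subn0 subnn !expr0 mulr1 mul1r bin0 binn !mulr1n -signr_odd l_odd expr1.
rewrite [X in X \in _](_ : _ =
  \sum_(1 <= i < l) x ^+ (l - i) * (-1) ^+ i *+ 'C(l, i)); last first.
  by rewrite opprB addrA subrK addrAC subrr add0r.
rewrite big_nat; apply: rpred_sum => i /andP[i_gt0 i_lt]; rewrite -mulr_natr dvlMl //.
  by rewrite rpredM ?rpredX ?rpredN1.
by rewrite dvl_nat // expn1 prime_dvd_bin // i_gt0.
Qed.

Lemma dvl_subr1_expX x k : x \in S ->
  (x - 1) ^+ (l ^ k) - (x ^+ (l ^ k) - 1) \in dvl 1.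
Proof.
move=> Sx; elim: k => [|k IH]; first by rewrite !expr1 subrr rpred0.
have Sx1 : x - 1 \in S by rewrite rpredB ?rpred1.
have Sy : x ^+ (l ^ k) \in S by rewrite rpredX.
rewrite expnSr !exprM -(subrK ((x ^+ (l ^ k) - 1) ^+ l) (((x - 1) ^+ _) ^+ l)).
rewrite -addrA rpredD //; last exact: dvl_subr1_exp.
by apply: dvl_subX => //; rewrite ?rpredX // rpredB ?rpred1.
Qed.

(** Frobenius modulo l turns this power into z^(a l^k) - 1 = 0, so z^a - 1 is topologically
    nilpotent. *)
Lemma dvl_root_sub1 (z : K) a k : z \in S -> z ^+ (l ^ k) = 1 ->
  (z ^+ a - 1) ^+ (l ^ k) \in dvl 1.
Proof.
move=> Sz z1; have := dvl_subr1_expX k (rpredX a Sz).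
by rewrite exprAC z1 expr1n subrr subr0.
Qed.

End FrobeniusPower.

Section PowerSeriesEvaluation.
Variables (l b : nat) (K : fieldType) (iota : {rmorphism padic l -> K}).
Hypotheses (l_pr : prime l) (l_odd : odd l) (l_neq0 : l%:R != 0 :> K).
Hypothesis b_gt0 : (0 < b)%N.
Variables (z : K) (n : nat) (a : 'I_b -> nat).
Hypothesis z1 : z ^+ (l ^ n) = 1.
Let t (i : 'I_b) : K := z ^+ a i - 1.
Local Notation dvl := (dvl (adjoin iota z) l).

Definition ps_partial (f : mpseries b (padic l)) d : K :=
  \sum_(m : 'X_{1..b < d}) iota (f m) * \prod_(i < b) t i ^+ m i.

Lemma t_in i : t i \in adjoin iota z.
Proof. by rewrite rpredB ?rpred1 // rpredX // adjoin_gen. Qed.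

(** By pigeonhole one of the b exponents is at least l^n k, and the l^n-th power of each [t i] is a
    multiple of l. *)
Lemma monomial_dvl (m : 'X_{1..b}) k : (b * l ^ n * k <= mdeg m)%N ->
  \prod_(i < b) t i ^+ m i \in dvl k.
Proof.
have Sm (P : pred 'I_b) : \prod_(i < b | P i) t i ^+ m i \in adjoin iota z.
  by apply: rpred_prod => i _; rewrite rpredX ?t_in.
case: k => [|k] m_big; first by rewrite dvl0.
have [i mi] : exists i, (l ^ n * k.+1 <= m i)%N.
  apply/existsP; apply: contraLR m_big; rewrite negb_exists -ltnNge => /forallP m_small.
  rewrite mdegE -mulnA; apply: (@leq_ltn_trans (\sum_(i < b) (l ^ n * k.+1).-1)).
    apply: leq_sum => i _; have := m_small i; rewrite -ltnNge.
    by case: (l ^ n * k.+1)%N.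
  rewrite sum_nat_const card_ord ltn_pmul2l // prednK // muln_gt0 expn_gt0.
  by rewrite prime_gt0.
rewrite (bigD1 i) //= dvlMr //; rewrite -(subnKC mi) exprD dvlMr ?rpredX ?t_in //.
rewrite exprM -[X in dvl X]mul1n; apply: dvlX.
by apply: dvl_root_sub1 => //; exact: adjoin_gen.
Qed.

Lemma coef_ps_trunc d (f : mpseries b (padic l)) m :
  (ps_trunc d f)@_m = if (mdeg m < d)%N then f m else 0.
Proof.
case: ltnP => [|dm]; first exact: ps_truncE.
rewrite /ps_trunc raddf_sum big1 //= => m' _; rewrite mcoeffZ mcoeffX.
case: eqP => [mm|_]; last by rewrite mulr0.
by have := bmdeg m'; rewrite mm ltnNge dm.
Qed.

Lemma msize_ps_trunc d (f : mpseries b (padic l)) : (msize (ps_trunc d f) <= d)%N.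
Proof.
rewrite /ps_trunc; apply: (leq_trans (mmeasure_sum _ _ _ _)).
apply/bigmax_leqP => m _; apply: leq_trans (mmeasureZ_le _ _ _) _.
by rewrite msizeX bmdeg.
Qed.

(** Gives partial sums of different orders a common index type, so that they can be subtracted
    termwise. *)
Lemma ps_partialE d D f : (d <= D)%N -> ps_partial f d =
  \sum_(m : 'X_{1..b < D}) iota (ps_trunc d f)@_m * \prod_(i < b) t i ^+ m i.
Proof.
move=> dD; transitivity (mmap iota t (ps_trunc d f)).
  rewrite (mmapE d (msize_ps_trunc d f)); apply: eq_bigr => m _.
  by rewrite coef_ps_trunc bmdeg.
by rewrite (mmapE D (leq_trans (msize_ps_trunc d f) dD)).
Qed.

Lemma ps_partial_dvl f d D k : (b * l ^ n * k <= d)%N -> (d <= D)%N ->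
  ps_partial f D - ps_partial f d \in dvl k.
Proof.
move=> kd dD; rewrite (ps_partialE f dD) (ps_partialE f (leqnn D)) -sumrB.
apply: rpred_sum => m _; rewrite -mulrBl -rmorphB !coef_ps_trunc bmdeg.
case: ltnP => [_|dm]; first by rewrite subrr rmorph0 mul0r rpred0.
by rewrite subr0 dvlMl ?adjoin_iota // monomial_dvl // (leq_trans kd).
Qed.

Lemma ps_partial_in f d : ps_partial f d \in adjoin iota z.
Proof.
apply: rpred_sum => m _; rewrite rpredM ?adjoin_iota //.
by apply: rpred_prod => i _; rewrite rpredX ?t_in.
Qed.

Lemma ps_eval_dvl f d k : (b * l ^ n * k <= d)%N ->
  ps_eval iota z t f \in adjoin iota z /\ ps_eval iota z t f - ps_partial f d \in dvl k.
Proof.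
pose C := (b * l ^ n)%N; have H_gt0 : (0 < l ^ n)%N by rewrite expn_gt0 prime_gt0.
have [|i|x Sx xU] := @adjoin_complete l K iota z l_neq0 _ H_gt0 z1 l_pr
    (fun i => ps_partial f (C * i)).
- exact: ps_partial_in.
- by apply: ps_partial_dvl; rewrite // leq_mul2l leqnSn orbT.
(* The default value of [adjoin_lim] is excluded since [x] is a limit. *)
rewrite /ps_eval /adjoin_lim; case: pselect => [h|[]]; last first.
  exists x; split; first exact/adjoinP.
  move=> N; exists (C * N)%N => e eN; apply/adjoin_eqmodP => //.
  rewrite -/(ps_partial f e).
  rewrite -(subrK (ps_partial f (C * N)) (ps_partial f e)) -addrA rpredD //.
    exact: ps_partial_dvl.
  by rewrite -opprB rpredN.
case: (cid h) => y /= [/adjoinP Sy y_lim] kd; split=> //.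
(* [y] is whichever limit [cid] picked; the partial sum at [maxn d0 d] is close both to [y] and to
   the partial sum at [d]. *)
have [d0 d0P] := y_lim k.
have /(adjoin_eqmodP _ _ l_neq0) := d0P _ (leq_maxl d0 d).
rewrite -/(ps_partial f (maxn d0 d)) => yD.
rewrite -(subrK (ps_partial f (maxn d0 d)) y) -addrA rpredD //.
  by rewrite -opprB rpredN.
exact: ps_partial_dvl (leq_maxr _ _).
Qed.

End PowerSeriesEvaluation.

(** * Truncated series as sums of characters *)

Section TruncationAsCharacterSum.
Variables (l b r : nat) (K : fieldType) (iota : {rmorphism padic l -> K}).
Variables (F : 'M[mpseries b (padic l)]_r) (D : nat).
Hypothesis l_pr : prime l.

(* [F i j], truncated at degree [D], as a polynomial in the [1 + T_k]. *)
Definition recentered i j : {mpoly (padic l)[b]} :=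
  \sum_(m : 'X_{1..b < D}) F i j m *: \prod_(k < b) ('X_k - 1) ^+ m k.
Definition letter_deg := (\max_(x : 'I_r * 'I_r) msize (recentered x.1 x.2))%N.
Definition letter : Type := 'I_r * 'I_r * 'X_{1..b < letter_deg}.
HB.instance Definition _ := Finite.on letter.
Definition letter_coef (x : letter) : padic l := (recentered x.1.1 x.1.2)@_x.2.
Definition letter_mx (x : letter) : 'M[K]_r := delta_mx x.1.1 x.1.2.
Definition letter_exp n (x : letter) : 'rV['Z_(l ^ n)]_b :=
  \row_k ((x.2 : 'X_{1..b}) k)%:R.

Lemma mmap_recentered (h : 'I_b -> K) i j : mmap iota h (recentered i j) =
  \sum_(m : 'X_{1..b < D}) iota (F i j m) * \prod_(k < b) (h k - 1) ^+ m k.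
Proof.
rewrite rmorph_sum; apply: eq_bigr => m _ /=.
rewrite mmapZ rmorph_prod; congr (_ * _); apply: eq_bigr => k _.
by rewrite rmorphXn rmorphB rmorph1 /= mmapX mmap1U.
Qed.

(** At 1 + T_k = z^(v_k), a monomial of exponent m in the 1 + T_k becomes the character z^(m v),
    linear in v; hence the recentring. *)
Lemma ps_partial_expsum n (z : K) (v : 'cV['Z_(l ^ n.+1)]_b) :
  z ^+ (l ^ n.+1) = 1 ->
  \matrix_(i, j) ps_partial iota z (fun k => v k 0 : 'Z_(l ^ n.+1)) (F i j) D =
  expsum iota letter_coef letter_mx z (@letter_exp n.+1) v.
Proof.
move=> z1; rewrite [LHS]matrix_sum_delta pair_big /= /expsum.
pose G (p : 'I_r * 'I_r) (m : 'X_{1..b < letter_deg}) : 'M[K]_r :=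
  (iota (recentered p.1 p.2)@_m * \prod_(k < b) (z ^+ v k 0) ^+ m k) *: delta_mx p.1 p.2.
transitivity (\sum_p \sum_m G p m).
  apply: eq_bigr => -[i j] _ /=; rewrite mxE /ps_partial.
  rewrite -(mmap_recentered (fun k => z ^+ v k 0)) (@mmapE _ _ _ _ _ _ letter_deg).
    by rewrite scaler_suml.
  exact: (@leq_bigmax _ (fun x : 'I_r * 'I_r => msize (recentered x.1 x.2)) (i, j)).
rewrite pair_big /=; apply: eq_bigr => -[[i j] m] _; congr ((_ * _) *: _).
rewrite mxE chi_sum //; apply: eq_bigr => k _.
by rewrite mxE -[v k 0 in RHS]natr_Zp -natrM chi_nat // mulnC exprM.
Qed.

End TruncationAsCharacterSum.

(** * The polynomials r_n *)

Section Periods.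
Variable P : pred nat.

Lemma leastP k : P k -> (forall j, P j -> (k <= j)%N) -> least P = k.
Proof.
move=> Pk k_min; rewrite /least; case: pselect => [h|[]]; last by exists k.
by case: ex_minnP => m Pm m_min; apply/eqP; rewrite eqn_leq m_min //= k_min.
Qed.

Lemma least_leq k : P k -> (least P <= k)%N.
Proof.
move=> Pk; rewrite /least; case: pselect => [h|//].
by case: ex_minnP => m _; exact.
Qed.

End Periods.

(** Induction on the level by [fix_red]. It makes Q invertible modulo l^(n+1) and its orbit lengths
    powers of l. *)
Lemma powl_fix (l b : nat) : prime l -> odd l -> forall n (Q B : 'M['Z_(l ^ n.+1)]_b) v,
  Q = 1%:M + l%:R *: B -> Q ^+ (l ^ n) *m v = v :> 'cV_b.
Proof.
move=> l_pr l_odd; elim=> [|n IH] Q B v QE.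
  have l0 : l%:R = 0 :> 'Z_(l ^ 1) by apply/eqP; rewrite Zl_natr_eq0 // expn1.
  by rewrite expr1 QE l0 scale0r addr0 mul1mx.
have [B' QE'] := power_1Dl QE (l ^ n).
have -> : Q ^+ (l ^ n.+1) = (Q ^+ (l ^ n)) ^+ l by rewrite -exprM -expnSr.
apply/eqP; rewrite (fix_red l_pr l_odd QE') red_map_mxX //.
have [f fE] := Zl_redP l_pr (leqnSn n).
rewrite (IH _ (map_mx (@Zl_red l n.+1 n) B)) //.
by apply/matrixP => i j; rewrite QE !mxE -!fE rmorphD rmorphM !rmorph_nat.
Qed.

Section RPolynomialAsOrbitPolynomial.
Variables (l b r n : nat) (Q B : 'M[padic l]_b).
Hypotheses (l_pr : prime l) (l_odd : odd l) (QE : Q = 1%:M + l%:R *: B).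
Local Notation V := 'cV['Z_(l ^ n.+1)]_b.

Definition modn_mx : 'M['Z_(l ^ n.+1)]_b := map_mx (@padic_modn l n.+1) Q.
Local Notation sigma := (fun v : V => modn_mx *m v).

Lemma modn_mxE : modn_mx = 1%:M + l%:R *: map_mx (@padic_modn l n.+1) B.
Proof.
have [f fE] := padic_modnP l_pr n.
by rewrite /modn_mx QE; apply/matrixP => i j; rewrite !mxE -!fE rmorphD rmorphM !rmorph_nat.
Qed.

Lemma QactE k (v : V) : Qact Q k v = modn_mx ^+ k *m v.
Proof.
have [f fE] := padic_modnP l_pr n.
have E m (C : 'M[padic l]_(b, m)) : map_mx (@padic_modn l n.+1) C = map_mx f C.
  by apply/matrixP => i j; rewrite !mxE fE.
rewrite /Qact /modn_mx !E; congr (_ *m _).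
elim: k => [|k IH]; first by rewrite !expr0 map_mx1.
by rewrite !exprS -!mulmxE map_mxM IH.
Qed.

Lemma modn_mx_inj : injective sigma.
Proof.
apply: (@can_inj _ _ _ (fun v => modn_mx ^+ (l ^ n).-1 *m v)) => v.
rewrite mulmx_exprSr prednK ?expn_gt0 ?prime_gt0 //.
exact: powl_fix modn_mxE.
Qed.

Lemma periodE (v : V) : period Q v = order sigma v.
Proof.
apply: leastP; first by rewrite order_gt0 QactE fix_order //=; exact: modn_mx_inj.
move=> j /andP[j_gt0]; rewrite QactE fix_order; last exact: modn_mx_inj.
exact: dvdn_leq.
Qed.

(** Orbit lengths being powers of l, those at least l^k are its multiples. *)
Lemma dvdn_period k : min_period Q n.+1 = (l ^ k)%N ->
  forall v : V, primitive_vec v -> (l ^ k %| order sigma v)%N.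
Proof.
move=> kE v v_prim; have : (order sigma v %| l ^ n)%N.
  by rewrite -(fix_order modn_mx_inj) (powl_fix l_pr l_odd _ modn_mxE).
case/(dvdn_pfactor _ _ l_pr) => j _ oE.
have : (l ^ k <= order sigma v)%N.
  rewrite -kE; apply: least_leq; apply/existsP; exists v.
  by rewrite v_prim periodE eqxx.
by rewrite oE leq_exp2l ?prime_gt1 // => kj; rewrite dvdn_exp2l.
Qed.

Lemma rpolyE (K : fieldType) (iota : {rmorphism padic l -> K}) zeta
    (F : 'M[mpseries b (padic l)]_r) (X : {set V}) :
  rpoly Q iota zeta F X =
  orbpoly modn_mx X (Fzeta iota zeta F (n := n.+1)) (min_period Q n.+1).
Proof.
apply: eq_bigr => v _; rewrite /ppoly periodE; congr (\det (_ - _ *: map_mx _ _) \Po _).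
rewrite /Amx /orbprod periodE big_mkord; apply: eq_bigr => j _.
by rewrite QactE /= -subn1 -subnDA add1n.
Qed.

End RPolynomialAsOrbitPolynomial.

(** * Proof of the congruences *)

Section Congruence.
Variables (l b r n e N : nat) (Q B : 'M[padic l]_b) (F : 'M[mpseries b (padic l)]_r).
Variables (K : fieldType) (iota : {rmorphism padic l -> K}) (zeta : nat -> K).
Hypotheses (l_pr : prime l) (l_odd : odd l) (l_neq0 : l%:R != 0 :> K).
Hypotheses (b_gt0 : (0 < b)%N) (N_gt0 : (0 < N)%N).
Hypothesis zeta1 : zeta n.+2 ^+ (l ^ n.+2) = 1.
Hypothesis zetaS : zeta n.+2 ^+ l = zeta n.+1.
Hypothesis QE : Q = 1%:M + l%:R *: B.
Hypothesis per0 : min_period Q n.+1 = (l ^ e)%N.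
Hypothesis per1 : min_period Q n.+2 = (l ^ e.+1)%N.
Local Notation z := (zeta n.+2).
Local Notation S := (adjoin iota z).
Hypothesis fixN : forall k beta,
  fixsum z (modn_mx n.+1 Q ^+ k) beta \in dvl S l N.

Lemma adjoin_trans (y x : K) : y \in S -> x \in adjoin iota y -> x \in S.
Proof.
move=> Sy /adjoinP[P ->]; rewrite horner_poly rpred_sum // => i _.
by rewrite rpredM ?adjoin_iota // rpredX.
Qed.

(** A single truncation degree, so that both levels share letters and coefficients. *)
Let D := maxn (b * l ^ n.+1 * N) (b * l ^ n.+2 * N).

Lemma Fzeta_trunc m (v : 'cV['Z_(l ^ m.+1)]_b) i j :
  zeta m.+1 ^+ (l ^ m.+1) = 1 -> zeta m.+1 \in S -> (b * l ^ m.+1 * N <= D)%N ->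
  eqmodI S (dvl S l N) (Fzeta iota zeta F v i j)
    (expsum iota (letter_coef (F := F) (D := D)) (@letter_mx l b r K F D)
       (zeta m.+1) (@letter_exp l b r F D m.+1) v i j).
Proof.
move=> z1 zS mD; rewrite -(ps_partial_expsum iota F D l_pr v z1) !mxE.
have [Sx xD] := ps_eval_dvl iota l_pr l_odd l_neq0 b_gt0
  (fun k => v k 0 : 'Z_(l ^ m.+1)) z1 (F i j) mD.
split; first exact: adjoin_trans Sx.
  by apply: (adjoin_trans zS); exact: ps_partial_in.
by move: xD; rewrite !dvlE; exact: adjoin_trans.
Qed.

Lemma red_modn_mx : map_mx (@Zl_red l n.+1 n) (modn_mx n.+1 Q) = modn_mx n Q.
Proof.
apply/matrixP => i j; rewrite !mxE /Zl_red /padic_modn; apply: val_inj.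
have l1 m : (1 < l ^ m.+1)%N by exact: expl_gt1.
rewrite [LHS]val_Zp_nat // [RHS]val_Zp_nat // val_Zp_nat //.
by rewrite modn_dvdm ?dvdn_exp2l // [in RHS]padic_resP (padic_baseE l_pr) modn_mod.
Qed.

Lemma red_letter_exp (x : letter F D) :
  map_mx (@Zl_red l n.+1 n) (letter_exp n.+2 x) = letter_exp n.+1 x.
Proof.
have [f fE] := Zl_redP l_pr (leqnSn n).
by apply/rowP => k; rewrite !mxE -fE rmorph_nat.
Qed.

Lemma orbit_representativesE m (X : {set 'cV['Z_(l ^ m.+1)]_b}) :
  orbit_representatives Q X -> (forall v, v \in X -> primitive_vec v) /\
  (forall v, primitive_vec v ->
     exists! x, x \in X /\ exists k, x = modn_mx m Q ^+ k *m v).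
Proof.
case=> X_prim X_repr; split=> // v /X_repr[x [[xX [k xE]] x_uniq]].
exists x; split; first by split=> //; exists k; rewrite xE QactE.
by move=> y [yX [k' yE]]; apply: x_uniq; split=> //; exists k'; rewrite yE QactE.
Qed.

Lemma rpoly_congr (X : {set 'cV['Z_(l ^ n.+1)]_b}) (X' : {set 'cV['Z_(l ^ n.+2)]_b}) :
  orbit_representatives Q X -> orbit_representatives Q X' ->
  poly_eqmod iota z N
    (rpoly Q iota zeta F X') (rpoly Q iota zeta F X ^+ (l ^ b.-1)).
Proof.
have l_gt0 := prime_gt0 l_pr.
move=> /orbit_representativesE[X_prim X_repr] /orbit_representativesE[X'_prim X'_repr].
have zS : zeta n.+1 \in S by rewrite -zetaS rpredX // adjoin_gen.
have zeta0 : zeta n.+1 ^+ (l ^ n.+1) = 1 by rewrite -zetaS -exprM -expnS.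
set c := letter_coef (F := F) (D := D); set E := @letter_mx l b r K F D.
pose F1 := expsum iota c E z (letter_exp n.+2).
pose F0 := expsum iota c E (zeta n.+1) (letter_exp n.+1).
have FF1 v i j := @Fzeta_trunc n.+1 v i j zeta1 (adjoin_gen _ _) (leq_maxr _ _).
have FF0 v i j := @Fzeta_trunc n v i j zeta0 zS (leq_maxl _ _).
rewrite !(rpolyE l_pr l_odd QE) per0 per1.
have k0_gt0 : (0 < l ^ e)%N by rewrite expn_gt0 l_gt0.
have k1_gt0 : (0 < l ^ e.+1)%N by rewrite expn_gt0 l_gt0.
have dvd0 := dvdn_period l_pr l_odd QE per0.
have dvd1 := dvdn_period l_pr l_odd QE per1.
have inj0 := modn_mx_inj l_pr l_odd (n := n) QE.
have inj1 := modn_mx_inj l_pr l_odd (n := n.+1) QE.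
have prim m v : primitive_vec (modn_mx m Q *m v) = primitive_vec v.
  by rewrite (modn_mxE m l_pr QE) primitive_1Dl.
have /eqmod_polyP[SD SP1 D1P1] :=
  eqmod_orbpoly FF1 k1_gt0 (fun v vX => dvd1 v (X'_prim v vX)).
have eq0 := eqmod_orbpoly FF0 k0_gt0 (fun v vX => dvd0 v (X_prim v vX)).
(* The power l^(b-1) is treated as a product of constant factors. *)
have := eqmodI_prod (@polyOver_idealM _ _ _ _) (index_enum 'I_(l ^ b.-1)) (Q := xpredT)
  (fun _ _ => eq0).
rewrite !prodr_const card_ord => /eqmod_polyP[SP0 SD0 P0D0].
rewrite -/c -/E -/F1 -/F0 in D1P1 P0D0 SD0 SP1.
have [t1 D1t1 t1E] := logder_orbpoly inj1 (prim _) X'_prim X'_repr F1 k1_gt0 dvd1.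
have [t0 D0t0 t0E] := logder_orbpoly inj0 (prim _) X_prim X_repr F0 k0_gt0 dvd0.
have DD i := logder_dvl l_neq0 l_pr N_gt0 SP1 SD0 (coef0_orbpoly X'_prim F1 k1_gt0 dvd1)
   _ D1t1 (logderX (l ^ b.-1) D0t0) _ i.
move=> i; apply/adjoin_eqmodP => //.
rewrite -(subrK (orbpoly (modn_mx n.+1 Q) X' F1 (l ^ e.+1))`_i (_)`_i) -addrA rpredD //.
  by rewrite -coefB (polyOverP D1P1).
rewrite -(subrK (orbpoly (modn_mx n Q) X F0 (l ^ e) ^+ (l ^ b.-1))`_i (_)`_i).
rewrite -addrA rpredD //; last first.
  by rewrite -opprB rpredN -coefB (polyOverP P0D0).
apply: DD => [|j j_gt0].
  by rewrite -horner_coef0 horner_exp horner_coef0 coef0_orbpoly // expr1n.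
(* Multiplying by k_(n+1) = l^(e+1) turns both terms into traces, as l^(e+1) l^(b-1) = l^b l^e; the
   e + 1 powers required are part of v_l(l j l^e). *)
rewrite -(dvlMXl _ l_neq0 e.+1) mulrBr -natrX t1E // mulrA -natrM.
have -> : (l ^ e.+1 * l ^ b.-1 = l ^ b * l ^ e)%N.
  by rewrite -!expnD addSnnS prednK // addnC.
rewrite natrM -mulrA t0E //.
have -> : (j * l ^ e.+1 = l * (j * l ^ e))%N by rewrite expnS mulnCA.
have -> : (e.+1 + (N + logn l j) = N + logn l (l * (j * l ^ e)))%N.
  rewrite !lognM ?muln_gt0 ?j_gt0 ?k0_gt0 ?l_gt0 // pfactorK //.
  rewrite (logn_prime l l_pr) eqxx; lia.
have := trsum_dvl l_pr l_odd l_neq0 (adjoin_iota iota z) _ zeta1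
  (modn_mxE n.+1 l_pr QE) c (E := E) (letter_exp n.+2) _ fixN.
rewrite red_modn_mx zetaS; have -> : (fun x => map_mx (@Zl_red l n.+1 n)
  (letter_exp (F := F) (D := D) n.+2 x)) = letter_exp n.+1.
  by apply: funext => x; exact: red_letter_exp.
apply.
- by move=> a; have [d dE] := padic_Fermat l_pr a;
    rewrite -rmorphXn -rmorphB dE rmorphM rmorph_nat dvlMr ?adjoin_iota // dvl_nat ?expn1.
- by move=> x; right; exists x.1.1, x.1.2.
- by rewrite muln_gt0 j_gt0.
Qed.

End Congruence.

Theorem theorem3p6 (l b r : nat)
    (Q : 'M[padic l]_b) (F : 'M[mpseries b (padic l)]_r)
    (K : fieldType) (iota : {rmorphism padic l -> K}) (zeta : nat -> K)
    (n0 : nat) :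
  prime l -> odd l -> (1 <= b)%N -> (1 <= r)%N ->
  (forall n, (l ^ n).-primitive_root (zeta n)) ->
  (forall n, zeta n.+1 ^+ l = zeta n) ->
  Q \in unitmx ->
  map_mx (@padic_modl l) Q = 1%:M ->
  (forall v : 'cV[padic l]_b, Q *m v = v -> v = 0) ->
  (forall n, (1 <= n)%N -> (n0 <= n)%N -> min_period Q n = (l ^ (n - n0))%N) ->
  (forall n, (1 <= n)%N -> (n < n0)%N -> min_period Q n = 1%N) ->
  F \in unitmx ->
  forall (n : nat) (X : {set 'cV['Z_(l ^ n)]_b})
         (X' : {set 'cV['Z_(l ^ n.+1)]_b}),
    (n0 <= n)%N ->
    orbit_representatives Q X ->
    orbit_representatives Q X' ->
    poly_eqmod iota (zeta n.+1) n
      (rpoly Q iota zeta F X') (rpoly Q iota zeta F X ^+ (l ^ b.-1))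
    /\ (forall q : padic l, Q = q%:M ->
          poly_eqmod iota (zeta n.+1) (n * b)
            (rpoly Q iota zeta F X') (rpoly Q iota zeta F X ^+ (l ^ b.-1))).
Proof.
move=> l_pr l_odd b_gt0 _ zeta_prim zetaS _ Q1 _ per _ _.
have [B QE] := padic_mx_1Dl l_pr Q1.
(* A primitive l-th root of unity excludes characteristic l. *)
have l_neq0 : l%:R != 0 :> K.
  have := prim_root_pcharF (zeta_prim 1%N) (dvdnn _); rewrite expn1.
  by rewrite inE l_pr /= => ->.
(* If n0 were 0, all periods modulo l would be multiples of l, whereas Q is the identity modulo l.
   This rules out n = 0, where 'Z_(l ^ n) is Z/2. *)
have n0_gt0 : (0 < n0)%N.
  rewrite lt0n; apply/eqP => n00.
  have per1 : min_period Q 1 = (l ^ 1)%N by have := per 1%N isT; rewrite n00 => ->.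
  pose v : 'cV['Z_(l ^ 1)]_b := const_mx 1.
  have v_prim : primitive_vec v.
    by apply/existsP; exists (Ordinal b_gt0); rewrite mxE unitr1.
  have := dvdn_period l_pr l_odd QE per1 v_prim; apply/negP.
  have : (order (fun v => modn_mx 0 Q *m v) v %| 1)%N.
    rewrite -(fix_order (modn_mx_inj l_pr l_odd (n := 0) QE)).
    by rewrite (powl_fix l_pr l_odd (n := 0) _ (modn_mxE 0 l_pr QE)).
  by rewrite dvdn1 => /eqP ->; rewrite expn1 dvdn1 gtn_eqF // prime_gt1.
case=> [|n] X X' n0n; first by rewrite leqn0 eqn0Ngt n0_gt0 in n0n.
move=> repX repX'.
have z1 : zeta n.+2 ^+ (l ^ n.+2) = 1 by exact: prim_expr_order.
have per0 := per n.+1 isT n0n.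
have per1 : min_period Q n.+2 = (l ^ (n.+1 - n0).+1)%N.
  by rewrite (per n.+2 isT (leqW n0n)) subSn.
have fixN k beta : fixsum (zeta n.+2) (modn_mx n.+1 Q ^+ k) beta
    \in dvl (adjoin iota (zeta n.+2)) l n.+1 by exact: fixsum_dvl.
split=> [|q Qq].
  exact: (rpoly_congr F l_pr l_odd l_neq0 b_gt0 _ z1 (zetaS _) QE per0 per1).
have Nb_gt0 : (0 < n.+1 * b)%N by rewrite muln_gt0.
apply: (rpoly_congr F l_pr l_odd l_neq0 b_gt0 Nb_gt0 z1 (zetaS _) QE per0 per1) => // k beta.
have [f fE] := padic_modnP l_pr n.+1.
have -> : modn_mx n.+1 Q ^+ k = (f q ^+ k)%:M.
  have -> : modn_mx n.+1 Q = (f q)%:M.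
    by apply/matrixP => i j; rewrite /modn_mx Qq !mxE -fE rmorphMn.
  by rewrite rmorphXn.
exact: fixsum_scalar_dvl.
Qed.
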